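(* There exist absolute constants $C_1,C_2,C_3>0$ such that the following holds. Let $n,M,q\ge1$, $\sigma>0$, $\mu\in\mathbb{R}^n$, and let $y=\mu+\varepsilon$ with $\varepsilon\sim N(0,\sigma^2I_{n\times n})$. Let $A_1,\dots,A_M$ be (deterministic) $n\times n$ matrices such that $$\{A_1,\dots,A_M\}\subset F_1\cup\dots\cup F_q,$$ where for each $k=1,\dots,q$, $F_k$ is a family of ordered linear smoothers in $\mathbb{R}^{n\times n}$. Let $\hat\theta$ be a solution of the optimization problem $$\hat\theta\in\mathop{\rm arg\,min}_{\theta\in\Lambda_M}\Big(C_p(A_\theta)+\frac12\sum_{j=1}^M\theta_j\|(A_\theta-A_j)y\|^2\Big).$$ Then $$\mathbb{E}\big[\|A_{\hat\theta}y-\mu\|^2\big]-\min_{j=1,\dots,M}\mathbb{E}\big[\|A_jy-\mu\|^2\big]\le C_1\sigma^2+C_2\sigma^2\log q.$$ Furthermore, if $j_*\in\mathop{\rm arg\,min}_{j=1,\dots,M}\mathbb{E}[\|A_jy-\mu\|^2]$, then for any $x\ge1$, $$\mathbb{P}\big\{\|A_{\hat\theta}y-\mu\|^2-\|A_{j_*}y-\mu\|^2\le C_2\sigma^2(x+\log q)\big\}\ge1-C_3e^{-x}.$$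
   Context: $\|\cdot\|$ is the Euclidean norm on $\mathbb{R}^n$. ''Absolute constant'' means a number not depending on any other quantity ($n$, $M$, $q$, $\mu$, $\sigma$, the matrices, $x$). Ordered linear smoothers: a family $\{B_1,\dots,B_m\}$ of real $n\times n$ matrices is a family of ordered linear smoothers if (i) each $B_j$ is symmetric and $0\le w^TB_jw\le\|w\|^2$ for all $w\in\mathbb{R}^n$; (ii) $B_jB_k=B_kB_j$ for all $j,k$; (iii) for all $j,k$, either $B_j\preceq B_k$ or $B_k\preceq B_j$, where $A\preceq B$ means that $B-A$ is positive semi-definite. Simplex: $\Lambda_M=\{\theta\in\mathbb{R}^M:\theta_j\ge0,\ \sum_{j=1}^M\theta_j=1\}$. For $\theta\in\Lambda_M$, $A_\theta=\sum_{j=1}^M\theta_jA_j$. Mallows' criterion: $C_p(A)=\|Ay-y\|^2+2\sigma^2\,\mathrm{trace}(A)$ for any $n\times n$ matrix $A$. *)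

(* Defs.v *)
From HB Require Import structures.
From mathcomp Require Export all_boot all_order all_algebra.
From mathcomp Require Export all_classical all_reals all_analysis.

Set Implicit Arguments.
Unset Strict Implicit.
Unset Printing Implicit Defensive.

Import Order.TTheory GRing.Theory Num.Theory.
Import numFieldNormedType.Exports.

Local Open Scope classical_set_scope.
Local Open Scope ring_scope.

(* The library norm on matrices is the sup norm, hence a separate definition *)
Definition enorm (R : realType) (n : nat) (v : 'cV[R]_n) : R :=
  Num.sqrt (\sum_(i < n) v i 0 ^+ 2).

Definition qform (R : realType) (n : nat) (B : 'M[R]_n) (w : 'cV[R]_n) : R :=
  (w^T *m B *m w) 0 0.

Definition psdmx (R : realType) (n : nat) (B : 'M[R]_n) : Prop :=
  B^T = B /\ forall w : 'cV[R]_n, 0 <= qform B w.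

Definition loewner_le (R : realType) (n : nat) (A B : 'M[R]_n) : Prop :=
  psdmx (B - A).

Definition ordered_linear_smoothers (R : realType) (n : nat)
    (F : set 'M[R]_n) : Prop :=
  [/\ finite_set F,
      forall B, F B ->
        B^T = B /\ forall w : 'cV[R]_n, 0 <= qform B w <= enorm w ^+ 2,
      forall B C, F B -> F C -> B *m C = C *m B
    & forall B C, F B -> F C -> loewner_le B C \/ loewner_le C B].

Definition simplex (R : realType) (M : nat) : set 'rV[R]_M :=
  [set theta | (forall j, 0 <= theta 0 j) /\ \sum_(j < M) theta 0 j = 1].

Definition lincomb (R : realType) (n M : nat) (A : 'I_M -> 'M[R]_n)
    (theta : 'rV[R]_M) : 'M[R]_n :=
  \sum_(j < M) theta 0 j *: A j.

Definition mallows_Cp (R : realType) (n : nat) (sigma : R) (y : 'cV[R]_n)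
    (A : 'M[R]_n) : R :=
  enorm (A *m y - y) ^+ 2 + 2 * sigma ^+ 2 * \tr A.

Definition Qagg_objective (R : realType) (n M : nat) (sigma : R)
    (A : 'I_M -> 'M[R]_n) (y : 'cV[R]_n) (theta : 'rV[R]_M) : R :=
  mallows_Cp sigma y (lincomb A theta) +
  2^-1 * \sum_(j < M) theta 0 j * enorm ((lincomb A theta - A j) *m y) ^+ 2.

Definition is_argmin (R : realType) (T : Type) (D : set T) (f : T -> R)
    (t : T) : Prop :=
  D t /\ forall t', D t' -> f t <= f t'.

Definition mutually_independent (d : measure_display) (T : measurableType d)
    (R : realType) (P : probability T R) (n : nat)
    (X : 'I_n -> {RV P >-> R}) : Prop :=
  forall (J : {set 'I_n}) (B : 'I_n -> set R),
    (forall i, measurable (B i)) ->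
    P (\bigcap_(i in [set` J]) (X i @^-1` B i)) =
    (\prod_(i in J) P (X i @^-1` B i))%E.

(* The law N(0, sigma^2 I_n): independent coordinates, each with law
   N(0, sigma^2); the second parameter of normal_prob is the standard
   deviation. *)
Definition isotropic_gaussian (d : measure_display) (T : measurableType d)
    (R : realType) (P : probability T R) (n : nat) (sigma : R)
    (eps : 'I_n -> {RV P >-> R}) : Prop :=
  mutually_independent eps /\
  forall (i : 'I_n) (B : set R), measurable B ->
    distribution P (eps i) B = normal_prob 0 sigma B.

Definition observation (d : measure_display) (T : measurableType d)
    (R : realType) (P : probability T R) (n : nat) (mu : 'cV[R]_n)
    (eps : 'I_n -> {RV P >-> R}) (w : T) : 'cV[R]_n :=
  mu + \col_i eps i w.

(* Main.v *)
(** For any fixed index [k], optimality of [thetahat] for the strongly convex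
    Q-aggregation objective gives
      [loss - loss_k <= sigma^2 * sum_j thetahat_j Delta_j], where, with
      [D = A_j - A_k], [y = sigma u] and [eps = sigma x],
      [Delta_j = 2 (x^T D u - tr D) - |D u|^2 / 2].
    Each [Delta_j] is a Gaussian quadratic with a negative drift of order
    [msq D = E |D u|^2], so it remains to bound [E exp (c max_j Delta_j)] by a
    constant for [j] in one ordered family; summing over the [q] families,
    Markov's inequality and [t <= ln q + e^t / q] give both claims.
    In one family, let [j0] minimize [msq (A_j - A_k)].  On either side of
    [A_j0] the increments are superadditive,
      [|(B - A) u|^2 + |(C - B) u|^2 <= |(C - A) u|^2] for [A <= B <= C],
    so [T_j = msq (A_j - A_j0)] controls [msq (A_i - A_j) <= |T_i - T_j|] while
    [msq (A_j - A_k) >= T_j / 4].  Cut the side into cells [m <= T_j < m + 1]: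
    chaining controls the fluctuations in a cell by a constant, the drift at
    its first point contributes [exp (- c m)], and the cells sum to a geometric
    series. *)

From HB Require Import structures.
Require Import Defs.
From mathcomp Require Import all_boot all_order all_algebra.
From mathcomp Require Import all_classical all_reals all_analysis.
From mathcomp Require Import measurable_realfun ring lra.
Import Order.TTheory GRing.Theory Num.Theory.
Import numFieldNormedType.Exports.
Set Implicit Arguments.
Unset Strict Implicit.
Unset Printing Implicit Defensive.
Local Open Scope classical_set_scope.
Local Open Scope ring_scope.

(** * Euclidean geometry and commuting positive matrices *)

Section EuclideanSpace.
Context {R : realType}.

(** A union bound over the M matrices would cost ln M. It is avoided because an ordered family is
    one-dimensional: superadditivity lets the potential T place it on the half-line, a unit interval
    has a net of mesh 2^-l with at most 2^l points, and increments over a distance t have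
    exponential moments at a rate of order t^(-1/2), so the chaining bound depends on neither M nor
    n. Cells are needed because the fluctuations grow with T; only the drift, of order T, outweighs
    them. The matrix A_k may lie in another family and need not commute with A_j, so distances along
    the chain cannot be measured from it. The nearest point A_j0 serves instead: T_j <= 2 msq (A_j -
    A_k) + 2 msq (A_k - A_j0) <= 4 msq (A_j - A_k), hence the factor 1/4. Nothing is diagonalized:
    superadditivity reduces to positivity of a product of commuting positive matrices, and Gaussian
    moments are computed by peeling off one coordinate at a time. The rate 1/1024 is what two
    midpoint convexity bounds for exp leave of the rates 1/512, 1/128 and 1/512 of the three pieces
    of an increment. *)

Definition dot n (u v : 'cV[R]_n) : R := (u^T *m v) 0 0.

Lemma dotE n (u v : 'cV[R]_n) : dot u v = \sum_i u i 0 * v i 0.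
Proof. by rewrite /dot mxE; apply: eq_bigr => i _; rewrite mxE. Qed.

Lemma dotC n (u v : 'cV[R]_n) : dot u v = dot v u.
Proof. by rewrite !dotE; apply: eq_bigr => i _; rewrite mulrC. Qed.

Lemma dotDl n (u v w : 'cV[R]_n) : dot (u + v) w = dot u w + dot v w.
Proof. by rewrite /dot linearD/= mulmxDl mxE. Qed.

Lemma dotDr n (u v w : 'cV[R]_n) : dot w (u + v) = dot w u + dot w v.
Proof. by rewrite /dot mulmxDr mxE. Qed.

Lemma dotZl n a (u v : 'cV[R]_n) : dot (a *: u) v = a * dot u v.
Proof. by rewrite /dot linearZ/= -scalemxAl mxE. Qed.

Lemma dotZr n a (u v : 'cV[R]_n) : dot u (a *: v) = a * dot u v.
Proof. by rewrite /dot -scalemxAr mxE. Qed.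

Lemma dotNl n (u v : 'cV[R]_n) : dot (- u) v = - dot u v.
Proof. by rewrite -scaleN1r dotZl mulN1r. Qed.

Lemma dotNr n (u v : 'cV[R]_n) : dot u (- v) = - dot u v.
Proof. by rewrite -scaleN1r dotZr mulN1r. Qed.

Lemma dotBl n (u v w : 'cV[R]_n) : dot (u - v) w = dot u w - dot v w.
Proof. by rewrite dotDl dotNl. Qed.

Lemma dotBr n (u v w : 'cV[R]_n) : dot w (u - v) = dot w u - dot w v.
Proof. by rewrite dotDr dotNr. Qed.

Lemma dot0l n (v : 'cV[R]_n) : dot 0 v = 0.
Proof. by rewrite -(scale0r 0) dotZl mul0r. Qed.

Lemma dot_suml n (I : Type) (r : seq I) (P : pred I) (F : I -> 'cV[R]_n) v :
  dot (\sum_(i <- r | P i) F i) v = \sum_(i <- r | P i) dot (F i) v.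
Proof.
apply: (big_morph (fun u => dot u v)); first by move=> x y; rewrite dotDl.
exact: dot0l.
Qed.

Lemma dot_mulmx m n (u : 'cV[R]_m) (A : 'M[R]_(m, n)) v :
  dot u (A *m v) = dot (A^T *m u) v.
Proof. by rewrite /dot trmx_mul trmxK mulmxA. Qed.

Lemma dot_ge0 n (u : 'cV[R]_n) : 0 <= dot u u.
Proof. by rewrite dotE; apply: sumr_ge0 => i _; rewrite -expr2 sqr_ge0. Qed.

Lemma dot_eq0 n (u : 'cV[R]_n) : (dot u u == 0) = (u == 0).
Proof.
apply/eqP/eqP => [|->]; last by rewrite dot0l.
rewrite dotE => /psumr_eq0P u0; apply/matrixP => i j; rewrite ord1 mxE.
have /eqP := u0 (fun i _ => ltac:(by rewrite -expr2 sqr_ge0)) i isT.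
by rewrite mulf_eq0 orbb => /eqP.
Qed.

Lemma dot_gt0 n (u : 'cV[R]_n) : u != 0 -> 0 < dot u u.
Proof. by move=> u0; rewrite lt_def dot_eq0 u0 dot_ge0. Qed.

Lemma dotDD n (u v : 'cV[R]_n) :
  dot (u + v) (u + v) = dot u u + 2 * dot u v + dot v v.
Proof. rewrite dotDl !dotDr (dotC v u); ring. Qed.

Lemma dotBB n (u v : 'cV[R]_n) :
  dot (u - v) (u - v) = dot u u - 2 * dot u v + dot v v.
Proof. rewrite dotDD dotNl !dotNr; ring. Qed.

Lemma dotDD_le n (u v : 'cV[R]_n) :
  dot (u + v) (u + v) <= 2 * dot u u + 2 * dot v v.
Proof. by rewrite dotDD; have := dot_ge0 (u - v); rewrite dotBB; lra. Qed.

Lemma dotBB_le n (u v : 'cV[R]_n) :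
  dot (u - v) (u - v) <= 2 * dot u u + 2 * dot v v.
Proof. by have := dotDD_le u (- v); rewrite dotNl (dotNr v) opprK. Qed.

Lemma dot_CS n (u v : 'cV[R]_n) : dot u v ^+ 2 <= dot u u * dot v v.
Proof.
have [->|v0] := eqVneq v 0; first by rewrite (dotC u) !dot0l mulr0 expr0n.
have := dot_ge0 (dot v v *: u - dot u v *: v).
rewrite dotBB !dotZl !dotZr => H; have := dot_gt0 v0.
set p := dot v v in H *; set q := dot u v in H *; set r := dot u u in H *.
move=> p0; rewrite -subr_ge0 -(pmulr_rge0 _ p0); nra.
Qed.

Lemma enorm_sqr n (v : 'cV[R]_n) : enorm v ^+ 2 = dot v v.
Proof.
rewrite /enorm sqr_sqrtr; last by apply: sumr_ge0 => i _; rewrite sqr_ge0.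
by rewrite dotE; apply: eq_bigr => i _; rewrite expr2.
Qed.

Lemma qformE n (B : 'M[R]_n) w : qform B w = dot w (B *m w).
Proof. by rewrite /qform /dot mulmxA. Qed.

Lemma qformB n (A B : 'M[R]_n) w : qform (A - B) w = qform A w - qform B w.
Proof. by rewrite !qformE mulmxBl dotBr. Qed.

Lemma qform_sqr n (B : 'M[R]_n) w :
  B^T = B -> qform (B *m B) w = dot (B *m w) (B *m w).
Proof. by move=> Bs; rewrite qformE -mulmxA dot_mulmx Bs. Qed.

Lemma sym_dotC n (B : 'M[R]_n) u v :
  B^T = B -> dot u (B *m v) = dot v (B *m u).
Proof. by move=> Bs; rewrite dot_mulmx Bs dotC. Qed.

Definition frob2 m n (D : 'M[R]_(m, n)) : R := \tr (D^T *m D).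

Lemma frob2E m n (D : 'M[R]_(m, n)) :
  frob2 D = \sum_j dot (D *m delta_mx j 0) (D *m delta_mx j 0).
Proof.
apply: eq_bigr => j _; rewrite dotE mxE; apply: eq_bigr => i _.
by rewrite mxE -colE mxE.
Qed.

Lemma frob2_ge0 m n (D : 'M[R]_(m, n)) : 0 <= frob2 D.
Proof. by rewrite frob2E; apply: sumr_ge0 => j _; exact: dot_ge0. Qed.

Lemma frob2_sym n (D : 'M[R]_n) : D^T = D -> frob2 D = \tr (D *m D).
Proof. by rewrite /frob2 => ->. Qed.

Lemma dot_mulmx_le_frob2 n (D : 'M[R]_n) u :
  dot (D *m u) (D *m u) <= frob2 D * dot u u.
Proof.
have -> : frob2 D = \sum_i dot (row i D)^T (row i D)^T.
  rewrite /frob2 mxtrace_mulC; apply: eq_bigr => i _.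
  by rewrite dotE mxE; apply: eq_bigr => j _; rewrite !mxE.
rewrite mulr_suml dotE; apply: ler_sum => i _.
rewrite -expr2 (_ : (D *m u) i 0 = dot (row i D)^T u); first exact: dot_CS.
by rewrite dotE mxE; apply: eq_bigr => j _; rewrite !mxE.
Qed.

Definition msq n (nu : 'cV[R]_n) (D : 'M[R]_n) : R :=
  dot (D *m nu) (D *m nu) + frob2 D.

Lemma msq_ge0 n nu (D : 'M[R]_n) : 0 <= msq nu D.
Proof. by rewrite addr_ge0 ?dot_ge0 ?frob2_ge0. Qed.

(** Since the sum runs over finitely many fixed vectors, an inequality between squares |D v|^2 that
    holds for every v passes to [msq]. *)
Lemma msq_sum n nu (D : 'M[R]_n) :
  msq nu D = \sum_(v <- nu :: [seq delta_mx j 0 | j <- index_enum 'I_n])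
    dot (D *m v) (D *m v).
Proof. by rewrite big_cons big_map /msq frob2E. Qed.

Lemma msqN n nu (D : 'M[R]_n) : msq nu (- D) = msq nu D.
Proof.
by rewrite !msq_sum; apply: eq_bigr => v _; rewrite mulNmx dotNl dotNr opprK.
Qed.

Lemma msqC n nu (D E : 'M[R]_n) : msq nu (D - E) = msq nu (E - D).
Proof. by rewrite -msqN opprB. Qed.

Lemma msq_addr n nu (D E F : 'M[R]_n) :
  (forall u, dot (D *m u) (D *m u) + dot (E *m u) (E *m u)
             <= dot (F *m u) (F *m u)) ->
  msq nu D + msq nu E <= msq nu F.
Proof.
by move=> h; rewrite !msq_sum -big_split/=; apply: ler_sum => v _; exact: h.
Qed.

Lemma msqD_le n nu (D E : 'M[R]_n) :
  msq nu (D + E) <= 2 * msq nu D + 2 * msq nu E.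
Proof.
rewrite !msq_sum !mulr_sumr -big_split/=; apply: ler_sum => v _.
by rewrite mulmxDl dotDD_le.
Qed.

Lemma frob2_le0 n (D : 'M[R]_n) : frob2 D <= 0 -> D = 0.
Proof.
move=> D0; have u0 (u : 'cV_n) : D *m u = 0.
  apply/eqP; rewrite -dot_eq0 eq_le dot_ge0 andbT.
  apply: (le_trans (dot_mulmx_le_frob2 _ _)).
  by rewrite mulr_le0_ge0 ?dot_ge0.
apply/matrixP => i j; have /matrixP/(_ i 0) := u0 (delta_mx j 0).
by rewrite -colE !mxE.
Qed.

Lemma msq_le0 n nu (D : 'M[R]_n) : msq nu D <= 0 -> D = 0.
Proof.
move=> D0; apply: frob2_le0; apply: le_trans D0.
by rewrite lerDr dot_ge0.
Qed.

(* Polarization: a symmetric matrix with numerical range in [-1, 1] is a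
   contraction. *)
Lemma sym_contraction n (D : 'M[R]_n) :
  D^T = D -> (forall w, `|qform D w| <= dot w w) ->
  forall v, dot (D *m v) (D *m v) <= dot v v.
Proof.
move=> Ds Dle v; set z := D *m v.
have h1 := Dle (z + v); have h2 := Dle (z - v).
rewrite qformE mulmxDr dotDD !dotDl !dotDr in h1.
rewrite qformE mulmxBr dotBB !dotBl !dotBr in h2.
have Ds' : dot v (D *m z) = dot z z by rewrite sym_dotC.
rewrite Ds' !ler_norml in h1 h2; rewrite -/z in h1 h2.
move: h1 h2 => /andP[_ h1] /andP[h2 _]; lra.
Qed.

Lemma frob2_mulmx_le n (D E : 'M[R]_n) :
  (forall v, dot (D *m v) (D *m v) <= dot v v) -> frob2 (D *m E) <= frob2 E.
Proof.
by move=> h; rewrite !frob2E; apply: ler_sum => j _; rewrite -mulmxA; exact: h.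
Qed.

Lemma frob2B_le n (D E : 'M[R]_n) :
  frob2 (D - E) <= 2 * frob2 D + 2 * frob2 E.
Proof.
rewrite !frob2E !mulr_sumr -big_split/=; apply: ler_sum => j _.
by rewrite mulmxBl dotBB_le.
Qed.

Lemma frob2Z m n a (D : 'M[R]_(m, n)) : frob2 (a *: D) = a ^+ 2 * frob2 D.
Proof.
rewrite !frob2E mulr_sumr; apply: eq_bigr => j _.
by rewrite -scalemxAl dotZl dotZr mulrA expr2.
Qed.

(** * Products of commuting positive semi-definite matrices *)

Section CommutingPsd.
Context {n : nat}.
Implicit Types E F : 'M[R]_n.

(* Riesz iteration: the iterates E_k of [E |-> E - E^2] satisfy
   [E = E_0^2 + ... + E_{k-1}^2 + E_k]. *)
Let riesz E k := iter k (fun B => B - B *m B) E.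

Let riesz_spec E k : E^T = E -> (forall w, 0 <= qform E w <= dot w w) ->
  (riesz E k)^T = riesz E k /\
  forall w, 0 <= qform (riesz E k) w <= dot w w.
Proof.
move=> Es Ele; elim: k => [|k]; first by split.
rewrite [riesz E k.+1]/=; set B := riesz E k => -[Bs Ble].
have BBs : (B - B *m B)^T = B - B *m B.
  by rewrite linearB/= trmx_mul Bs.
split=> // w; apply/andP; split; last first.
  rewrite qformB qform_sqr// lerBlDr (le_trans (proj2 (andP (Ble w))))//.
  by rewrite lerDl dot_ge0.
(* B - B^2 = (1 - B) B (1 - B) + B (1 - B) B, and both terms are nonnegative when 0 <= B <= 1. *)
have /andP[+ _] := Ble (w - B *m w); have /andP[_] := Ble (B *m w).
rewrite qformB qform_sqr// !qformE mulmxBr dotBl !dotBr.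
rewrite (sym_dotC _ (B *m w) Bs); have := dot_ge0 (B *m w); lra.
Qed.

Let riesz_comm E F k : E *m F = F *m E -> riesz E k *m F = F *m riesz E k.
Proof.
move=> EF; elim: k => [//|k]; rewrite [riesz E k.+1]/=; set B := riesz E k => BF.
by rewrite mulmxBl mulmxBr BF -(mulmxA B B F) BF !mulmxA BF.
Qed.

(** Each E_i F E_i is positive, so <E v, F v> >= <E_k v, F v> for every k. The squares |E_i v|^2
    have sum at most |v|^2, hence some E_i v is as small as desired, and a negative value of <E v, F
    v> is impossible. *)
Lemma comm_psd_mul E F v :
  E^T = E -> (forall w, 0 <= qform E w <= dot w w) -> psdmx F ->
  E *m F = F *m E -> 0 <= dot (E *m v) (F *m v).
Proof.
move=> Es Ele [Fs Fge] EF.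
have sumE w k : dot (E *m v) w =
    \sum_(i < k) dot (riesz E i *m v) (riesz E i *m w)
    + dot (riesz E k *m v) w.
  elim: k => [|k IH]; first by rewrite big_ord0 add0r.
  rewrite IH big_ord_recr/= -addrA; congr (_ + _).
  have [Bs _] := riesz_spec k Es Ele; set B := riesz E k in Bs *.
  by rewrite mulmxBl dotBl -mulmxA (dot_mulmx _ B w) Bs; ring.
have ge_k k : dot (riesz E k *m v) (F *m v) <= dot (E *m v) (F *m v).
  rewrite (sumE _ k) lerDr; apply: sumr_ge0 => i _.
  by rewrite mulmxA riesz_comm// -mulmxA -qformE Fge.
have sq_small k : exists i, dot (riesz E i *m v) (riesz E i *m v) * k%:R
    <= dot v v.
  have [[i Pi]|Pn] := pselect (exists i, dot (riesz E i *m v) (riesz E i *m v) * k%:R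
    <= dot v v); first by exists i.
  have gtv (i : nat) : dot v v < dot (riesz E i *m v) (riesz E i *m v) * k%:R.
    by rewrite ltNge; apply/negP => h; apply: Pn; exists i.
  exfalso; have := sumE v k; have /andP[_] := Ele v; rewrite qformE dotC => le1 eq1.
  have [Bs /(_ v)/andP[+ _]] := riesz_spec k Es Ele.
  rewrite qformE dotC => ge1.
  case: k => [|k] in Pn gtv eq1 Bs ge1 *.
    by have := gtv 0; rewrite mulr0 ltNge dot_ge0.
  have : \sum_(i < k.+1) dot v v < \sum_(i < k.+1)
      dot (riesz E i *m v) (riesz E i *m v) * k.+1%:R.
    apply: ltr_sum => [|i _]; last exact: gtv.
    by apply/hasP; exists ord0; rewrite ?mem_index_enum.
  rewrite -mulr_suml sumr_const card_ord -(mulr_natr (dot v v)) ltr_pM2r ?ltr0n//.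
  lra.
rewrite leNgt; apply/negP => lt0.
set c := dot (E *m v) (F *m v) in ge_k lt0.
set f := dot (F *m v) (F *m v).
(* With k > |v|^2 |F v|^2 / c^2 and |E_i v|^2 <= |v|^2 / k, Cauchy-Schwarz contradicts <E_i v, F v>
   <= c < 0. *)
pose k := (Num.truncn (dot v v * f / c ^+ 2)).+1.
have [i ile] := sq_small k.
have c2 : 0 < c ^+ 2 by rewrite exprn_even_gt0//= lt_eqF.
have kb : dot v v * f < k%:R * c ^+ 2.
  by rewrite -ltr_pdivrMr//; exact: truncnS_gt.
have := dot_CS (riesz E i *m v) (F *m v); have := ge_k i.
set d := dot (riesz E i *m v) (F *m v); rewrite -/f => dc dle.
have cd : c ^+ 2 <= d ^+ 2 by nra.
have f0 : 0 <= f := dot_ge0 _.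
have k0 : 0 <= k%:R :> R by rewrite ler0n.
have : k%:R * c ^+ 2 <= dot v v * f.
  apply: (@le_trans _ _ (dot (riesz E i *m v) (riesz E i *m v) * k%:R * f)).
    by rewrite mulrAC mulrC ler_wpM2r// (le_trans cd).
  by rewrite ler_wpM2r.
by rewrite leNgt kb.
Qed.

End CommutingPsd.
End EuclideanSpace.

(** * Gaussian integrals *)

Section NormalLaw.
Context {R : realType}.
Local Notation mu := (@lebesgue_measure R).

Lemma ge0_integral_normal_prob (m sigma : R) (f : R -> \bar R) :
  (forall x, 0 <= f x)%E -> measurable_fun setT f ->
  (\int[normal_prob m sigma]_x f x
   = \int[mu]_x (f x * (normal_pdf m sigma x)%:E))%E.
Proof.
move=> f0 mf; have dom := normal_prob_dominates m sigma.
rewrite -(Radon_Nikodym_SigmaFinite.change_of_variables dom)//.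
have fi := Radon_Nikodym_SigmaFinite.f_integrable dom.
have mpdf : measurable_fun setT (EFin \o normal_pdf m sigma).
  by apply/measurable_EFinP; exact: measurable_normal_pdf.
apply: ae_eq_integral => //.
- by apply: emeasurable_funM => //; exact: measurable_int fi.
- exact: emeasurable_funM.
- apply: ae_eqe_mul2l; apply: integral_ae_eq => //.
  by move=> E _ mE; rewrite -Radon_Nikodym_SigmaFinite.f_integral.
Qed.

(** Completing the square turns the integrand times the density into p^(-1/2) exp (b^2 / (2 p))
    times the density of the normal law with mean sigma b / p and variance sigma^2 / p. *)
Lemma integral_normal_expR_quadratic (sigma p b : R) : 0 < sigma -> 0 < p ->
  (\int[normal_prob 0 sigma]_z
     (expR (2^-1 * (1 - p) * (z / sigma) ^+ 2 + b * (z / sigma)))%:E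
   <= (expR (2^-1 * (p^-1 - 1) + 2^-1 * (b ^+ 2 / p)))%:E)%E.
Proof.
move=> s0 p0.
have mE : measurable_fun setT
    (fun z : R => expR (2^-1 * (1 - p) * (z / sigma) ^+ 2 + b * (z / sigma))).
  apply: measurableT_comp => //.
  have mz : measurable_fun setT (fun z : R => z / sigma).
    exact: measurable_funM.
  apply: measurable_funD; last exact: measurable_funM.
  by apply: measurable_funM => //; exact: measurable_funX.
rewrite ge0_integral_normal_prob//; last exact/measurable_EFinP.
have sp0 : 0 < Num.sqrt p by rewrite sqrtr_gt0.
have sp2 : Num.sqrt p ^+ 2 = p by rewrite sqr_sqrtr// ltW.
set c := (Num.sqrt p)^-1 * expR (2^-1 * (b ^+ 2 / p)).
have sN0 : sigma != 0 by rewrite gt_eqF.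
have ssN0 : sigma / Num.sqrt p != 0 by rewrite gt_eqF// divr_gt0.
have spN0 : Num.sqrt p != 0 by rewrite gt_eqF.
under eq_integral => z _.
  rewrite (_ : _ * _ = c%:E
      * (normal_pdf (sigma * b / p) (sigma / Num.sqrt p) z)%:E)%E; last first.
    rewrite !normal_pdfE// -!EFinM; congr EFin.
    have -> : normal_peak (sigma / Num.sqrt p)
        = Num.sqrt p * normal_peak sigma.
      rewrite /normal_peak expr_div_n sp2.
      rewrite -!mulrnAr (_ : sigma ^+ 2 / p * (pi *+ 2)
        = p^-1 * (sigma ^+ 2 * (pi *+ 2))); last by ring.
      rewrite sqrtrM ?invr_ge0 ?(ltW p0)// sqrtrV ?(ltW p0)//.
      by rewrite invfM invrK.
    rewrite /c /normal_fun.
    set e1 := expR (2^-1 * (b ^+ 2 / p)); set e2 := expR (- (z - _) ^+ 2 / _).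
    have aux (u v w r : R) : u != 0 -> u^-1 * v * (u * w * r) = w * (v * r).
      by move=> u0; field.
    rewrite aux//.
    rewrite /e1 /e2 => {e1 e2}.
    rewrite mulrCA; congr (_ * _); rewrite -!expRD; congr expR.
    rewrite (expr_div_n sigma) sp2 -(mulr_natr (sigma ^+ 2 / p)) -mulr_natr.
    by field; rewrite sN0 gt_eqF.
  over.
rewrite ge0_integralZl//; last 3 first.
- by apply/measurable_EFinP; exact: measurable_normal_pdf.
- by move=> x _; rewrite lee_fin normal_pdf_ge0.
- by rewrite lee_fin mulr_ge0 ?expR_ge0 ?invr_ge0 ?sqrtr_ge0.
rewrite integral_normal_pdf mule1 lee_fin expRD ler_wpM2r ?expR_ge0//.
(* Squared, what remains is p^-1 <= exp (p^-1 - 1). *)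
rewrite -ler_sqr ?nnegrE ?invr_ge0 ?sqrtr_ge0 ?expR_ge0//.
rewrite exprVn sp2 -expRM_natl.
rewrite mulrA mulfV// mul1r.
by have := expR_ge1Dx (p^-1 - 1); rewrite addrC subrK.
Qed.

End NormalLaw.

(** * Independence of the first coordinate from the others *)

Section IndependentLaw.
Context d (T : measurableType d) {R : realType} (P : probability T R).
Local Open Scope ereal_scope.

Let boxes n : set (set (n.-tuple R)) :=
  [set S | exists B : 'I_n -> set R,
     (forall i, measurable (B i)) /\ S = [set t | forall i, B i (tnth t i)]].

Let boxes_generate n :
  @measurable _ (n.-tuple R) = <<s @boxes n >>.
Proof.
apply/seteqP; split.
- rewrite {1}/measurable/= /g_sigma_preimage.
  apply: smallest_sub; first exact: smallest_sigma_algebra.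
  case: n => [|n]; first by rewrite big_ord0.
  rewrite -bigcup_mkord_ord => S [k kn [B mB <-]].
  apply: sub_gen_smallest.
  exists (fun i => if i == inord k then B else setT); split.
    by move=> i; case: ifP.
  rewrite setTI; apply/seteqP; split=> [t Bt i|t /(_ (inord k))].
    by case: ifPn => // /eqP ->.
  by rewrite eqxx.
- apply: smallest_sub; first exact: sigma_algebra_measurable.
  move=> _ [B [mB ->]].
  rewrite (_ : [set _ | _] = \bigcap_(i in [set: 'I_n])
      ((fun t : n.-tuple R => tnth t i) @^-1` B i)); last first.
    by apply/seteqP; split=> t /= h i; [move=> _; exact: h|exact: h].
  apply: fin_bigcap_measurable => // i _.
  by rewrite -[X in measurable X]setTI; exact: measurable_tnth.
Qed.

Let boxes_setI n : setI_closed (@boxes n).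
Proof.
move=> _ _ [B [mB ->]] [C [mC ->]]; exists (fun i => B i `&` C i); split.
  by move=> i; exact: measurableI.
by apply/seteqP; split=> [t [hB hC] i|t h]; [split|split=> i; case: (h i)].
Qed.

Definition tail_tuple n (X : 'I_n.+1 -> {RV P >-> R}) (w : T) : n.-tuple R :=
  [tuple X (lift ord0 i) w | i < n].

Lemma measurable_tail_tuple n (X : 'I_n.+1 -> {RV P >-> R}) :
  measurable_fun setT (tail_tuple X).
Proof.
apply/measurable_fun_tnthP => i.
rewrite (_ : _ \o _ = X (lift ord0 i)); first exact: measurable_funP.
by apply/funext => w /=; rewrite tnth_mktuple.
Qed.

Lemma mutually_independentT n (X : 'I_n -> {RV P >-> R}) (B : 'I_n -> set R) :
  mutually_independent X -> (forall i, measurable (B i)) ->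
  P [set w | forall i, B i (X i w)] = \prod_i P (X i @^-1` B i).
Proof.
move=> indX mB; have := indX [set: 'I_n]%SET B mB.
rewrite [in RHS](eq_bigl predT) => [<-|i]; last by rewrite inE.
by congr (P _); apply/seteqP; split=> w /= h i; [move=> _|apply: h; rewrite /= inE].
Qed.

Lemma mutually_independent_lift n (X : 'I_n.+1 -> {RV P >-> R}) (i0 : 'I_n.+1) :
  mutually_independent X ->
  mutually_independent (fun i => X (lift i0 i) : {RV P >-> R}).
Proof.
move=> indX J B mB.
pose C i := if unlift i0 i is Some j then B j else setT.
have := indX (lift i0 @: J) C.
rewrite big_imset/=; last by move=> i j _ _; exact: lift_inj.
rewrite (eq_bigr (fun j => P (X (lift i0 j) @^-1` B j))); last first.
  by move=> j _; rewrite /C liftK.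
move=> <-; last by move=> i; rewrite /C; case: unlift.
congr (P _); apply/seteqP; split=> w /= h.
- move=> _ /= /imsetP[j jJ ->]; rewrite /C liftK; exact: h.
- by move=> j /= jJ; have := h (lift i0 j); rewrite /C liftK/=; apply; exact: imset_f.
Qed.

(** For fixed [B] both sides are finite measures in [A]. They agree on measurable rectangles by
    mutual independence, and rectangles form a generating pi-system. *)
Lemma independent_tail n (X : 'I_n.+1 -> {RV P >-> R}) (A : set (n.-tuple R))
    (B : set R) :
  mutually_independent X -> measurable A -> measurable B ->
  P (tail_tuple X @^-1` A `&` X ord0 @^-1` B)
  = P (tail_tuple X @^-1` A) * P (X ord0 @^-1` B).
Proof.
move=> indX mA mB.
have mXB : measurable (X ord0 @^-1` B).
  by rewrite -[X in measurable X]setTI; exact: measurable_funP.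
have mY := measurable_tail_tuple X.
have PB0 : (0 <= fine (P (X ord0 @^-1` B)))%R by exact: fine_ge0.
have : (fine (P (X ord0 @^-1` B)))%:E = P (X ord0 @^-1` B).
  by rewrite fineK// fin_num_measure.
move: (fine _) PB0 => c PB0 PBE; rewrite muleC -PBE.
apply: (@measure_unique _ R _ (@boxes n) (fun=> setT) _ _ _ _
  (pushforward (mrestr P mXB) (tail_tuple X))
  (mscale (NngNum PB0) (pushforward P (tail_tuple X)))) => //.
- exact: boxes_generate.
- exact: boxes_setI.
- by move=> _; exists (fun=> setT); split=> //; apply/seteqP; split.
- by rewrite bigcup_const.
- move=> _ [C [mC ->]].
  transitivity (P (X ord0 @^-1` B)
    * P (tail_tuple X @^-1` [set t | forall i, C i (tnth t i)]));
    last by rewrite -PBE.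
  rewrite /= /pushforward /mrestr.
  (* [B] in slot 0 gives the joint probability; the whole line in slot 0 gives the law of the tail
     alone. *)
  have mC' : forall i, measurable (if unlift ord0 i is Some j then C j else B).
    by move=> i; case: unlift.
  have mC'' : forall i, measurable (if unlift ord0 i is Some j then C j else setT).
    by move=> i; case: unlift.
  have := mutually_independentT indX mC''.
  rewrite big_ord_recl/= unlift_none preimage_setT probability_setT mul1e.
  under eq_bigr do rewrite liftK.
  rewrite (_ : [set _ | _]
    = tail_tuple X @^-1` [set t | forall i, C i (tnth t i)]); last first.
    apply/seteqP; split=> w /= h i.
    - by rewrite tnth_mktuple; have := h (lift ord0 i); rewrite liftK.
    - by case: unliftP => //= j ->; have := h j; rewrite tnth_mktuple.
  move=> ->; have := mutually_independentT indX mC'.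
  rewrite big_ord_recl/= unlift_none.
  under eq_bigr do rewrite liftK.
  move=> <-; congr (P _); apply/seteqP; split=> w /=.
  - move=> [h hB] i; case: unliftP => /= [j ->|->//].
    by have := h j; rewrite tnth_mktuple.
  - move=> h; split=> [i|]; last by have := h ord0; rewrite unlift_none.
    by rewrite tnth_mktuple; have := h (lift ord0 i); rewrite liftK.
- move=> _; rewrite /= /pushforward /mrestr setTI.
  by rewrite (le_lt_trans (probability_le1 _ _)) ?ltry.
Qed.

End IndependentLaw.

Section IndependentTail.
Context d (T : measurableType d) {R : realType} (P : probability T R).
Local Open Scope ereal_scope.

HB.instance Definition _ n (X : 'I_n.+1 -> {RV P >-> R}) :=
  isMeasurableFun.Build _ _ _ _ (tail_tuple X) (measurable_tail_tuple X).

(** The joint law of tail and head is the product of their laws, so by Tonelli the head can be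
    integrated first with the tail frozen. *)
Lemma ge0_integral_independent_tail n (X : 'I_n.+1 -> {RV P >-> R})
    (f : n.-tuple R * R -> \bar R) :
  mutually_independent X -> measurable_fun setT f -> (forall x, 0 <= f x) ->
  \int[P]_w f (tail_tuple X w, X ord0 w)
  = \int[P]_w \int[distribution P (X ord0)]_z f (tail_tuple X w, z).
Proof.
move=> indX mf f0.
have mYX : measurable_fun setT (fun w => (tail_tuple X w, X ord0 w)).
  by apply: measurable_fun_pair => //; exact: measurable_tail_tuple.
have := ge0_integral_pushforward mYX P measurableT mf (fun y _ => f0 y).
rewrite preimage_setT => /= <-.
rewrite (eq_measure_integral
  (distribution P (tail_tuple X) \x distribution P (X ord0))%E); last first.
  move=> A mA _; apply/esym; apply: product_measure_unique => //.
  by move=> A1 A2 mA1 mA2; exact: independent_tail.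
rewrite fubini_tonelli1//= /fubini_F.
rewrite ge0_integral_distribution//.
- exact: measurable_fun_fubini_tonelli_F.
- by move=> y; exact: integral_ge0.
Qed.

End IndependentTail.

Section MeasurableVectors.
Context d (T : measurableType d) {R : realType}.

Definition measurable_mx m n (F : T -> 'M[R]_(m, n)) :=
  forall i j, measurable_fun setT (fun w => F w i j).

Lemma measurable_mx_cst m n (A : 'M[R]_(m, n)) : measurable_mx (fun=> A).
Proof. by move=> i j; exact: measurable_cst. Qed.

Lemma measurable_mxD m n (F G : T -> 'M[R]_(m, n)) :
  measurable_mx F -> measurable_mx G -> measurable_mx (fun w => F w + G w).
Proof.
move=> mF mG i j; under eq_fun do rewrite mxE.
exact: measurable_funD.
Qed.

Lemma measurable_mxN m n (F : T -> 'M[R]_(m, n)) :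
  measurable_mx F -> measurable_mx (fun w => - F w).
Proof.
by move=> mF i j; under eq_fun do rewrite mxE; exact: measurableT_comp.
Qed.

Lemma measurable_mxB m n (F G : T -> 'M[R]_(m, n)) :
  measurable_mx F -> measurable_mx G -> measurable_mx (fun w => F w - G w).
Proof. by move=> mF mG; apply: measurable_mxD => //; exact: measurable_mxN. Qed.

Lemma measurable_mxM m n p (F : T -> 'M[R]_(m, n)) (G : T -> 'M[R]_(n, p)) :
  measurable_mx F -> measurable_mx G -> measurable_mx (fun w => F w *m G w).
Proof.
move=> mF mG i j; under eq_fun do rewrite mxE.
by apply: measurable_sum => k; exact: measurable_funM.
Qed.

Lemma measurable_dot n (F G : T -> 'cV[R]_n) :
  measurable_mx F -> measurable_mx G ->
  measurable_fun setT (fun w => dot (F w) (G w)).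
Proof.
move=> mF mG; under eq_fun do rewrite dotE.
by apply: measurable_sum => k; exact: measurable_funM.
Qed.

End MeasurableVectors.

(** * Splitting off the first coordinate *)

Section HeadTail.
Context {R : realType} {n : nat}.
Implicit Types (u v : 'cV[R]_n.+1) (A : 'M[R]_n.+1).

Definition vtail u : 'cV[R]_n := \col_i u (lift ord0 i) 0.
Definition mtail A : 'M[R]_n := \matrix_(i, j) A (lift ord0 i) (lift ord0 j).
Definition vcons (a : R) (u : 'cV[R]_n) : 'cV[R]_n.+1 :=
  \col_i if unlift ord0 i is Some j then u j 0 else a.

Lemma vtail_cons a (u : 'cV_n) : vtail (vcons a u) = u.
Proof. by apply/matrixP => i j; rewrite ord1 !mxE liftK. Qed.

Lemma vcons0 a (u : 'cV_n) : vcons a u ord0 0 = a.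
Proof. by rewrite mxE unlift_none. Qed.

Lemma dot_tail u v : dot u v = u ord0 0 * v ord0 0 + dot (vtail u) (vtail v).
Proof.
rewrite !dotE big_ord_recl; congr (_ + _).
by apply: eq_bigr => i _; rewrite !mxE.
Qed.

Lemma mulmx_head A u : A^T = A ->
  (A *m u) ord0 0 = A ord0 ord0 * u ord0 0 + dot (vtail (col ord0 A)) (vtail u).
Proof.
move=> As; rewrite mxE big_ord_recl dotE; congr (_ + _).
by apply: eq_bigr => i _; rewrite !mxE -[in LHS]As mxE.
Qed.

Lemma mulmx_tail A u :
  vtail (A *m u) = u ord0 0 *: vtail (col ord0 A) + mtail A *m vtail u.
Proof.
apply/matrixP => i j; rewrite ord1 !mxE big_ord_recl mulrC; congr (_ + _).
by apply: eq_bigr => k _; rewrite !mxE.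
Qed.

Lemma mtail_sym A : A^T = A -> (mtail A)^T = mtail A.
Proof. by move=> As; apply/matrixP => i j; rewrite !mxE -[in LHS]As mxE. Qed.

Lemma trmx_tail A : \tr A = A ord0 ord0 + \tr (mtail A).
Proof.
rewrite /mxtrace big_ord_recl; congr (_ + _).
by apply: eq_bigr => i _; rewrite mxE.
Qed.

Lemma qform_tail A u : A^T = A ->
  dot u (A *m u) = A ord0 ord0 * u ord0 0 ^+ 2
    + 2 * u ord0 0 * dot (vtail (col ord0 A)) (vtail u)
    + dot (vtail u) (mtail A *m vtail u).
Proof.
move=> As; rewrite dot_tail mulmx_head// mulmx_tail dotDr dotZr.
rewrite (dotC (vtail u) (vtail (col _ _))); ring.
Qed.

End HeadTail.

(** * Gaussian exponents and Schur complements *)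

Section GaussianQuadratic.
Context d (T : measurableType d) {R : realType} (P : probability T R).

Definition gvec n (sigma : R) (X : 'I_n -> {RV P >-> R}) (w : T) : 'cV[R]_n :=
  \col_i (X i w / sigma).

Lemma measurable_gvec n sigma (X : 'I_n -> {RV P >-> R}) :
  measurable_mx (gvec sigma X).
Proof.
move=> i j; under eq_fun do rewrite mxE.
by apply: measurable_funM => //; exact: measurable_funP.
Qed.

Lemma isotropic_gaussian_lift n sigma (X : 'I_n.+1 -> {RV P >-> R}) :
  isotropic_gaussian sigma X ->
  isotropic_gaussian sigma (fun i => X (lift ord0 i) : {RV P >-> R}).
Proof.
by move=> [indX lawX]; split=> [|i]; [exact: mutually_independent_lift|exact: lawX].
Qed.

Lemma integral_gaussian_coord n sigma (X : 'I_n -> {RV P >-> R}) i p b :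
  isotropic_gaussian sigma X -> 0 < sigma -> 0 < p ->
  (\int[distribution P (X i)]_z
     (expR (2^-1 * (1 - p) * (z / sigma) ^+ 2 + b * (z / sigma)))%:E
   <= (expR (2^-1 * (p^-1 - 1) + 2^-1 * (b ^+ 2 / p)))%:E)%E.
Proof.
move=> [_ lawX] s0 p0; apply: le_trans (integral_normal_expR_quadratic b s0 p0).
(* The identity, read as a map from [measurableTypeR R] to [R]; pushing [normal_prob] forward along
   it gives a measure on the same type as [distribution P (X i)]. *)
pose phi (z : measurableTypeR R) : R := z.
have mphi : measurable_fun setT phi by move=> _ A mA; rewrite setTI.
rewrite (eq_measure_integral (pushforward (normal_prob 0 sigma) phi)) => [|A mA _].
  rewrite ge0_integral_pushforward//.
  apply/measurable_EFinP; apply: measurableT_comp => //.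
  have mz : measurable_fun setT (fun z : R => z / sigma).
    exact: measurable_funM.
  apply: measurable_funD; last exact: measurable_funM.
  by apply: measurable_funM => //; exact: measurable_funX.
exact: lawX.
Qed.

(* The exponent turning a standard normal density into one with precision
   matrix [Q] and linear term [b]. *)
Definition gauss_exponent n (Q : 'M[R]_n) (b x : 'cV[R]_n) : R :=
  2^-1 * (dot x x - dot x (Q *m x)) + dot b x.

Definition schur n (Q : 'M[R]_n.+1) : 'M[R]_n :=
  mtail Q - (Q ord0 ord0)^-1 *: (vtail (col ord0 Q) *m (vtail (col ord0 Q))^T).

Definition schur_vec n (Q : 'M[R]_n.+1) (b : 'cV[R]_n.+1) : 'cV[R]_n :=
  vtail b - (b ord0 0 / Q ord0 ord0) *: vtail (col ord0 Q).

Lemma mulmx_outer n (v u : 'cV[R]_n) : v *m v^T *m u = dot v u *: v.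
Proof.
rewrite -mulmxA; apply/matrixP => i j; rewrite ord1 mxE big_ord1 [RHS]mxE mulrC.
by congr (_ * _); rewrite /dot; congr (fun_of_matrix _ _ _); rewrite ord1.
Qed.

Lemma schur_mul n (Q : 'M[R]_n.+1) (u : 'cV_n) :
  schur Q *m u = mtail Q *m u
    - (dot (vtail (col ord0 Q)) u / Q ord0 ord0) *: vtail (col ord0 Q).
Proof.
by rewrite /schur mulmxBl -scalemxAl mulmx_outer scalerA mulrC.
Qed.

Lemma gauss_exponent_head n (Q : 'M[R]_n.+1) b x : Q^T = Q ->
  gauss_exponent Q b x = 2^-1 * (1 - Q ord0 ord0) * (x ord0 0) ^+ 2
    + (b ord0 0 - dot (vtail (col ord0 Q)) (vtail x)) * x ord0 0
    + gauss_exponent (mtail Q) (vtail b) (vtail x).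
Proof.
move=> Qs; rewrite /gauss_exponent qform_tail// (dot_tail x) (dot_tail b).
by field.
Qed.

(** Integrating out the first coordinate produces the square (b_0 - <v, u>)^2 / (2 p), where v is
    the rest of the first column and p the pivot. Expanding it shows which matrix and linear term
    remain. *)
Lemma gauss_exponent_schur n (Q : 'M[R]_n.+1) (b : 'cV_n.+1) u : Q ord0 ord0 != 0 ->
  2^-1 * ((b ord0 0 - dot (vtail (col ord0 Q)) u) ^+ 2 / Q ord0 ord0)
    + gauss_exponent (mtail Q) (vtail b) u
  = 2^-1 * (b ord0 0 ^+ 2 / Q ord0 ord0)
    + gauss_exponent (schur Q) (schur_vec Q b) u.
Proof.
move=> p0; rewrite /gauss_exponent schur_mul dotBr dotZr /schur_vec dotBl dotZl.
by rewrite (dotC u (vtail (col _ _))); field.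
Qed.

Definition posdef n (Q : 'M[R]_n) := forall x : 'cV_n, x != 0 -> 0 < dot x (Q *m x).

Lemma posdef_head n (Q : 'M[R]_n.+1) : Q^T = Q -> posdef Q -> 0 < Q ord0 ord0.
Proof.
move=> Qs Qpd; have := Qpd (vcons 1 0).
have x0 : vcons 1 0 != 0 :> 'cV[R]_n.+1.
  apply/eqP => /matrixP/(_ ord0 0); rewrite vcons0 mxE.
  by move/eqP; rewrite oner_eq0.
move=> /(_ x0); rewrite qform_tail// vcons0 vtail_cons dotC !dot0l expr1n.
by rewrite mulr1 mulr0 !addr0.
Qed.

Lemma posdef_schur n (Q : 'M[R]_n.+1) : Q^T = Q -> posdef Q -> posdef (schur Q).
Proof.
move=> Qs Qpd u u0; have p0 := posdef_head Qs Qpd.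
set v := vtail (col ord0 Q).
(* This first entry minimizes x^T Q x among vectors with tail u; the minimum is the quadratic form
   of [schur Q] at u. *)
pose x := vcons (- (dot v u / Q ord0 ord0)) u.
have x0 : x != 0.
  apply: contra u0 => /eqP x0; apply/eqP/matrixP => i j.
  by have /matrixP/(_ (lift ord0 i) 0) := x0; rewrite !mxE liftK ord1.
have := Qpd _ x0; rewrite qform_tail// vcons0 vtail_cons schur_mul dotBr dotZr.
rewrite -/v (dotC u v); set a := dot v u; set p := Q _ _ in p0 *.
rewrite (_ : p * _ ^+ 2 + _ + _ = dot u (mtail Q *m u) - a / p * a)//.
by field; rewrite gt_eqF.
Qed.

Lemma schur_sym n (Q : 'M[R]_n.+1) : Q^T = Q -> (schur Q)^T = schur Q.
Proof.
by move=> Qs; rewrite /schur linearB/= linearZ/= trmx_mul trmxK mtail_sym.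
Qed.

Section Inverse.
Context {n : nat} (Q K : 'M[R]_n.+1).
Hypotheses (Qs : Q^T = Q) (Ks : K^T = K) (Qpd : posdef Q).
Hypothesis QK : forall u : 'cV_n.+1, Q *m (K *m u) = u.
Let p := Q ord0 ord0.
Let v := vtail (col ord0 Q).
Let k := vtail (col ord0 K).

Let p0 : p != 0. Proof. by rewrite gt_eqF// posdef_head. Qed.

Let kE u : dot k u = - (dot v (mtail K *m u) / p).
Proof.
have := QK (vcons 0 u) => /matrixP/(_ ord0 0).
rewrite mulmx_head// mulmx_head// mulmx_tail vcons0 vtail_cons scale0r add0r.
rewrite mulr0 add0r -/p -/v -/k => h.
by apply: (mulfI p0); rewrite -[LHS](addrK (dot v (mtail K *m u))) h; field.
Qed.

(** Block inversion: read off the tail of Q K (0, u) = (0, u), after eliminating <k, u> by the head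
    of the same identity, [kE]. *)
Lemma schurK (u : 'cV_n) : schur Q *m (mtail K *m u) = u.
Proof.
have := congr1 (@vtail R n) (QK (vcons 0 u)).
rewrite mulmx_tail mulmx_head// mulmx_tail vcons0 vtail_cons scale0r add0r.
rewrite mulr0 add0r -/v -/k kE schur_mul => h.
by rewrite -[RHS]h -/v -/p scaleNr addrC.
Qed.

Lemma inverse_head :
  K ord0 ord0 = p^-1 + dot v (mtail K *m v) / p ^+ 2.
Proof.
have := QK (vcons 1 0) => /matrixP/(_ ord0 0).
rewrite mulmx_head// mulmx_head// mulmx_tail vcons0 vtail_cons scale1r.
rewrite mulmx0 addr0 (dotC _ 0) dot0l mulr1 addr0 -/p -/v -/k dotC kE => h.
have -> : K ord0 ord0
   = (p * K ord0 ord0 - dot v (mtail K *m v) / p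
      + dot v (mtail K *m v) / p) / p by field.
by rewrite h; field.
Qed.

(** The extra term in [inverse_head] is a value of the quadratic form of [schur Q], up to the factor
    p^-2. Used at every pivot in turn, the bound keeps the sum of the inverse pivots below tr K. *)
Lemma inverse_head_ge : p^-1 <= K ord0 ord0.
Proof.
rewrite inverse_head lerDl mulr_ge0 ?invr_ge0 ?sqr_ge0//.
have [->|z0] := eqVneq (mtail K *m v) 0; first by rewrite dotC dot0l.
have := posdef_schur Qs Qpd z0; rewrite schurK dotC; exact: ltW.
Qed.

Lemma qform_inverse (b : 'cV_n.+1) :
  dot b (K *m b) = b ord0 0 ^+ 2 / p
    + dot (schur_vec Q b) (mtail K *m schur_vec Q b).
Proof.
rewrite qform_tail// inverse_head -/k kE /schur_vec -/p -/v.
rewrite mulmxBr -scalemxAr dotBl !dotBr !dotZl !dotZr.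
rewrite (sym_dotC (vtail b) v (mtail_sym Ks)); by field.
Qed.

End Inverse.

(* Integrating out the first coordinate replaces [Q] by its Schur complement;
   bounding [p^(-1/2) <= exp ((p^-1 - 1) / 2)] at each pivot [p] turns the
   determinant of the exact formula into a trace. *)
Lemma expectation_gauss_exponent n sigma (X : 'I_n -> {RV P >-> R})
    (Q K : 'M[R]_n) b :
  isotropic_gaussian sigma X -> 0 < sigma ->
  Q^T = Q -> K^T = K -> posdef Q -> (forall u : 'cV_n, Q *m (K *m u) = u) ->
  (\int[P]_w (expR (gauss_exponent Q b (gvec sigma X w)))%:E
   <= (expR (2^-1 * (\tr K - n%:R) + 2^-1 * dot b (K *m b)))%:E)%E.
Proof.
move=> gX s0; elim: n X Q K b gX => [|n IH] X Q K b gX Qs Ks Qpd QK.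
  rewrite (eq_integral (cst 1%E)) => [|w _].
    rewrite integral_cst// mul1e (_ : _ [set: _] = 1%E) ?lee_fin; last exact: probability_setT.
    by rewrite /mxtrace dotE !big_ord0 subrr !mulr0 addr0 expR0.
  by rewrite /gauss_exponent !dotE !big_ord0 subrr mulr0 addr0 expR0.
have p0 := posdef_head Qs Qpd; set p := Q _ _ in p0.
set v := vtail (col ord0 Q).
pose X' : 'I_n -> {RV P >-> R} := fun i => X (lift ord0 i).
have gX' : isotropic_gaussian sigma X' by exact: isotropic_gaussian_lift.
pose xt (t : n.-tuple R) : 'cV[R]_n := \col_i (tnth t i / sigma).
have xtE w : xt (tail_tuple X w) = gvec sigma X' w.
  by apply/matrixP => i j; rewrite !mxE tnth_mktuple.
pose rest t := gauss_exponent (mtail Q) (vtail b) (xt t).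
pose coef t := b ord0 0 - dot v (xt t).
pose f (tz : n.-tuple R * R) : \bar R :=
  (expR (2^-1 * (1 - p) * (tz.2 / sigma) ^+ 2 + coef tz.1 * (tz.2 / sigma)
         + rest tz.1))%:E.
have fE w : (expR (gauss_exponent Q b (gvec sigma X w)))%:E
    = f (tail_tuple X w, X ord0 w).
  rewrite gauss_exponent_head//; congr (expR _)%:E.
  rewrite /f /= /coef /rest xtE mxE; congr (_ + _ * _ + _).
    by congr (_ - dot _ _); apply/matrixP => i j; rewrite !mxE.
  by congr gauss_exponent; apply/matrixP => i j; rewrite !mxE.
have mxt : measurable_mx xt.
  move=> i j; under eq_fun do rewrite mxE.
  by apply: measurable_funM => //; exact: measurable_tnth.
have mcoef : measurable_fun setT coef.
  by apply: measurable_funB => //; apply: measurable_dot => //; exact: measurable_mx_cst.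
have mrest : measurable_fun setT rest.
  apply: measurable_funD; last first.
    by apply: measurable_dot => //; exact: measurable_mx_cst.
  apply: measurable_funM => //; apply: measurable_funB; apply: measurable_dot => //.
  by apply: measurable_mxM => //; exact: measurable_mx_cst.
have mf : measurable_fun setT f.
  apply/measurable_EFinP; apply: measurableT_comp => //.
  have m2 : measurable_fun setT (fun tz : n.-tuple R * R => tz.2 / sigma).
    by apply: measurable_funM => //; exact: measurable_snd.
  apply: measurable_funD; last exact: measurableT_comp.
  apply: measurable_funD.
    by apply: measurable_funM => //; exact: measurable_funX.
  by apply: measurable_funM => //; exact: measurableT_comp.
have f0 tz : (0 <= f tz)%E by rewrite lee_fin expR_ge0.
under eq_integral do rewrite fE.
rewrite (ge0_integral_independent_tail (proj1 gX) mf f0).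
set c := 2^-1 * (p^-1 - 1) + 2^-1 * (b ord0 0 ^+ 2 / p).
pose h w := (expR (gauss_exponent (schur Q) (schur_vec Q b) (gvec sigma X' w)))%:E.
have mh : measurable_fun setT h.
  apply/measurable_EFinP; apply: measurableT_comp => //.
  have mg := measurable_gvec sigma X'.
  apply: measurable_funD; last first.
    by apply: measurable_dot => //; exact: measurable_mx_cst.
  apply: measurable_funM => //; apply: measurable_funB; apply: measurable_dot => //.
  by apply: measurable_mxM => //; exact: measurable_mx_cst.
apply: (@le_trans _ _ (\int[P]_w ((expR c)%:E * h w))%E).
  apply: ge0_le_integral => //.
  - by move=> w _; exact: integral_ge0.
  - have := @measurable_fun_fubini_tonelli_F _ _ _ _ _ (distribution P (X ord0)) f mf f0.
    move=> mF; apply: (measurableT_comp mF); exact: measurable_tail_tuple.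
  - exact: measurable_funeM.
  move=> w _; rewrite /f /=; set t := tail_tuple X w.
  under eq_integral do rewrite expRD EFinM.
  rewrite ge0_integralZr//; last first.
    apply/measurable_EFinP; apply: measurableT_comp => //.
    have mz : measurable_fun setT (fun z : R => z / sigma) by exact: measurable_funM.
    apply: measurable_funD; last exact: measurable_funM.
    by apply: measurable_funM => //; exact: measurable_funX.
  apply: (@le_trans _ _ ((expR (2^-1 * (p^-1 - 1) + 2^-1 * (coef t ^+ 2 / p)))%:E
      * (expR (rest t))%:E)%E).
    apply: lee_wpmul2r; first by rewrite lee_fin expR_ge0.
    exact: integral_gaussian_coord.
  rewrite /h -!EFinM lee_fin -!expRD ler_expR /c -!addrA lerD2l.
  have := gauss_exponent_schur b (xt t) (lt0r_neq0 p0).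
  by rewrite -/v -/p xtE /coef /rest xtE => ->.
rewrite ge0_integralZl//; last by move=> w _; rewrite lee_fin expR_ge0.
apply: (@le_trans _ _ ((expR c)%:E * (expR (2^-1 * (\tr (mtail K) - n%:R)
    + 2^-1 * dot (schur_vec Q b) (mtail K *m schur_vec Q b)))%:E)%E).
  apply: lee_wpmul2l; first by rewrite lee_fin expR_ge0.
  apply: IH => //.
  - exact: schur_sym.
  - exact: mtail_sym.
  - exact: posdef_schur.
  - by move=> u; apply: schurK.
rewrite -EFinM lee_fin -expRD ler_expR (qform_inverse Qs Ks Qpd QK) trmx_tail.
have := inverse_head_ge Qs Ks Qpd QK; rewrite -/p /c -[n.+1%:R]natr1; lra.
Qed.

End GaussianQuadratic.

(** * Exponential moments of the centered and squared processes *)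

Section GaussianChaos.
Context d (T : measurableType d) {R : realType} (P : probability T R).
Context {n : nat} (sigma : R) (X : 'I_n -> {RV P >-> R}).
Hypotheses (gX : isotropic_gaussian sigma X) (s0 : 0 < sigma).

Lemma mxtrace_dot (A : 'M[R]_n) :
  \tr A = \sum_i dot (delta_mx i 0) (A *m delta_mx i 0).
Proof.
apply: eq_bigr => i _; rewrite -colE dotE (bigD1 i)//= !mxE !eqxx mul1r.
by rewrite big1 ?addr0// => j /negbTE ji; rewrite !mxE ji mul0r.
Qed.

Lemma posdef_unitmx (Q : 'M[R]_n) : Q^T = Q -> posdef Q -> Q \in unitmx.
Proof.
move=> Qs Qpd; rewrite -row_free_unit -kermx_eq0; apply/rowV0P => r /sub_kermxP rQ.
apply: trmx_inj; rewrite trmx0; apply/eqP; apply: contraT => r0.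
have := Qpd _ r0; rewrite -[X in X *m _]Qs -trmx_mul rQ trmx0.
by rewrite dotC dot0l ltxx.
Qed.

(* With [K = (1 - S)^-1 <= 2], the expansion [K = 1 + S + S K S] bounds
   [tr K - n] by [tr S + 2 |S|_F^2]. *)
Lemma expectation_expR_quadratic (S : 'M[R]_n) b c :
  S^T = S -> (forall v : 'cV_n, dot v (S *m v) <= 2^-1 * dot v v) ->
  (\int[P]_w (expR (c + 2^-1 * dot (gvec sigma X w) (S *m gvec sigma X w)
                   + dot b (gvec sigma X w)))%:E
   <= (expR (c + 2^-1 * \tr S + frob2 S + dot b b))%:E)%E.
Proof.
move=> Ss Sle; pose Q : 'M[R]_n := 1%:M - S.
have Qs : Q^T = Q by rewrite /Q linearB/= trmx1 Ss.
have Qge (v : 'cV_n) : 2^-1 * dot v v <= dot v (Q *m v).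
  by rewrite /Q mulmxBl mul1mx dotBr; have := Sle v; lra.
have Qpd : posdef Q.
  move=> v v0; apply: lt_le_trans (Qge v); rewrite mulr_gt0//; exact: dot_gt0.
have Qu := posdef_unitmx Qs Qpd; pose K := invmx Q.
have QK (u : 'cV_n) : Q *m (K *m u) = u by rewrite mulmxA mulmxV// mul1mx.
have Ks : K^T = K by rewrite /K trmx_inv Qs.
have Kle (v : 'cV_n) : dot v (K *m v) <= 2 * dot v v.
  (* Q >= 1/2 gives |K v|^2 <= 2 <v, K v>; with |2 v - K v|^2 >= 0 this yields <v, K v> <= 2
     |v|^2. *)
  have := Qge (K *m v); rewrite QK (dotC (K *m v) v).
  have := dot_ge0 (2 *: v - K *m v); rewrite dotBB !dotZl !dotZr; lra.
have KE : K = 1%:M + S + S *m K *m S.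
  have h1 : K = 1%:M + S *m K.
    have : Q *m K = 1%:M by rewrite mulmxV.
    by rewrite /Q mulmxBl mul1mx => <-; rewrite subrK.
  have h2 : K = 1%:M + K *m S.
    have : K *m Q = 1%:M by rewrite mulVmx.
    by rewrite /Q mulmxBr mulmx1 => <-; rewrite subrK.
  by rewrite [LHS]h1 [in LHS]h2 mulmxDr mulmx1 addrA mulmxA.
have trSKS : \tr (S *m K *m S) <= 2 * frob2 S.
  rewrite mxtrace_dot frob2E mulr_sumr; apply: ler_sum => i _.
  by rewrite -!mulmxA dot_mulmx Ss; exact: Kle.
have := expectation_gauss_exponent b gX s0 Qs Ks Qpd QK.
under [X in _ -> (X <= _)%E]eq_integral do rewrite -addrA expRD EFinM.
rewrite ge0_integralZl//; last first.
  apply/measurable_EFinP; apply: measurableT_comp => //.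
  have mg := measurable_gvec sigma X.
  apply: measurable_funD; last first.
    by apply: measurable_dot => //; exact: measurable_mx_cst.
  apply: measurable_funM => //; apply: measurable_dot => //.
  by apply: measurable_mxM => //; exact: measurable_mx_cst.
move=> H; rewrite -!addrA expRD EFinM lee_wpmul2l// ?lee_fin ?expR_ge0//.
rewrite (eq_integral (fun w => (expR (gauss_exponent Q b (gvec sigma X w)))%:E)).
  apply: (le_trans H); rewrite lee_fin ler_expR.
  have := Kle b; rewrite [in \tr K]KE !mxtraceD mxtrace1; lra.
move=> w _; rewrite /gauss_exponent /Q mulmxBl mul1mx dotBr.
by congr (expR (_ * _ + _))%:E; ring.
Qed.

Context (nu : 'cV[R]_n).

(* With [x] standard normal, [gproc D x] is centered and [msq nu D] is the mean
   of [nproc D x]. *)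
Definition gproc (D : 'M[R]_n) (x : 'cV[R]_n) : R :=
  dot x (D *m (nu + x)) - \tr D.

Definition nproc (D : 'M[R]_n) (x : 'cV[R]_n) : R :=
  dot (D *m (nu + x)) (D *m (nu + x)).

Lemma gprocB D E x : gproc (D - E) x = gproc D x - gproc E x.
Proof. rewrite /gproc mulmxBl dotBr linearB/=; ring. Qed.

Lemma gprocD D E x : gproc (D + E) x = gproc D x + gproc E x.
Proof. rewrite /gproc mulmxDl dotDr mxtraceD; ring. Qed.

Lemma gproc_quadratic D x : D^T = D ->
  gproc D x = dot x (D *m x) + dot (D *m nu) x - \tr D.
Proof. move=> Ds; rewrite /gproc mulmxDr dotDr (dotC x (D *m nu)); ring. Qed.

Lemma nproc_quadratic D x : D^T = D ->
  nproc D x = dot x (D *m D *m x) + 2 * dot (D *m D *m nu) x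
              + dot (D *m nu) (D *m nu).
Proof.
move=> Ds; rewrite /nproc mulmxDr dotDD -!mulmxA.
have symD u v : dot (D *m u) v = dot u (D *m v) by rewrite dot_mulmx Ds.
by rewrite !symD; ring.
Qed.

Local Notation E f := (\int[P]_w (expR (f (gvec sigma X w)))%:E)%E.

(** Take S = 2 s D and b = s D nu. The trace in [gproc] cancels tr S / 2, leaving 4 s^2 |D|_F^2 +
    s^2 |D nu|^2 <= 4 s^2 [msq nu D] <= 1/4. The same hypothesis gives |S v| <= |v| / 2. *)
Lemma expectation_expR_gproc D s : D^T = D -> 16 * s ^+ 2 * msq nu D <= 1 ->
  (E (fun x => s * gproc D x) <= (expR 4^-1)%:E)%E.
Proof.
move=> Ds sD.
have := @expectation_expR_quadratic ((2 * s) *: D) (s *: (D *m nu)) (- (s * \tr D)).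
rewrite linearZ/= Ds => /(_ erefl).
have fr : frob2 D <= msq nu D by rewrite /msq lerDr dot_ge0.
have cond (v : 'cV_n) : dot v (2 * s *: D *m v) <= 2^-1 * dot v v.
  have CS := dot_CS v (2 * s *: D *m v).
  have le2 : dot (2 * s *: D *m v) (2 * s *: D *m v) <= 4^-1 * dot v v.
    rewrite -scalemxAl dotZl dotZr mulrA -expr2.
    have sf : 16 * s ^+ 2 * frob2 D <= 1.
      by apply: le_trans sD; rewrite ler_wpM2l// mulr_ge0// sqr_ge0.
    have := ler_wpM2l (sqr_ge0 s) (dot_mulmx_le_frob2 D v).
    have := ler_wpM2r (dot_ge0 v) sf; lra.
  set a := dot v _ in CS *; set e := dot (_ *m _) _ in CS le2.
  have v0 := dot_ge0 v; nra.
move=> /(_ cond) H; apply: le_trans (le_trans H _); last first.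
  rewrite lee_fin ler_expR mxtraceZ frob2Z dotZl dotZr.
  move: sD fr; rewrite /msq; have := frob2_ge0 D; have := dot_ge0 (D *m nu).
  move: (frob2 D) (dot _ _) => f e; have := sqr_ge0 s; nra.
rewrite le_eqVlt; apply/orP; left; apply/eqP; apply: eq_integral => w _.
congr (expR _)%:E; rewrite gproc_quadratic// -scalemxAl dotZr dotZl; by field.
Qed.

(** |D|_F <= 1 makes D a contraction, so the terms in D^2 are bounded by those in D and the exponent
    is at most (s + 4 s^2) [msq nu D] <= 1/2. *)
Lemma expectation_expR_nproc D s : D^T = D -> msq nu D <= 1 ->
  0 <= s <= 4^-1 -> (E (fun x => s * nproc D x) <= (expR 2^-1)%:E)%E.
Proof.
move=> Ds D1 /andP[s_ge0 s_le].
have fr : frob2 D <= msq nu D by rewrite /msq lerDr dot_ge0.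
have Dc (v : 'cV_n) : dot (D *m v) (D *m v) <= dot v v.
  apply: (le_trans (dot_mulmx_le_frob2 _ _)).
  by rewrite ler_piMl ?dot_ge0// (le_trans fr).
have := @expectation_expR_quadratic ((2 * s) *: (D *m D))
  ((2 * s) *: (D *m D *m nu)) (s * dot (D *m nu) (D *m nu)).
rewrite linearZ/= trmx_mul Ds => /(_ erefl).
have cond (v : 'cV_n) : dot v (2 * s *: (D *m D) *m v) <= 2^-1 * dot v v.
  rewrite -scalemxAl dotZr -mulmxA dot_mulmx Ds.
  have := Dc v; have := dot_ge0 v; have := dot_ge0 (D *m v); nra.
move=> /(_ cond) H; apply: le_trans (le_trans H _); last first.
  rewrite lee_fin ler_expR mxtraceZ frob2Z dotZl dotZr -frob2_sym//.
  have := frob2_mulmx_le D Dc; rewrite -(mulmxA D D nu); have := Dc (D *m nu).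
  move: fr D1; rewrite /msq; have := frob2_ge0 D; have := frob2_ge0 (D *m D).
  have := dot_ge0 (D *m nu); have := dot_ge0 (D *m (D *m nu)).
  move: (frob2 D) (frob2 _) (dot _ _) (dot _ _) => a b e f; nra.
rewrite le_eqVlt; apply/orP; left; apply/eqP; apply: eq_integral => w _.
congr (expR _)%:E; rewrite nproc_quadratic// -scalemxAl dotZr dotZl; by field.
Qed.

(** The traces of first order in D cancel and the mean of [nproc] leaves a drift of - s/4
    [msq nu D]. The second-order terms cost at most 33 s^2 [msq nu D], which is half of the drift
    once s <= 1/264 = 1/(8 . 33). *)
Lemma expectation_expR_center D s : D^T = D ->
  (forall v : 'cV_n, `|qform D v| <= dot v v) -> 0 <= s <= 264^-1 ->
  (E (fun x => s * (2 * gproc D x - 4^-1 * nproc D x))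
   <= (expR (- (s / 8 * msq nu D)))%:E)%E.
Proof.
move=> Ds Dq /andP[s_ge0 s_le]; have Dc := sym_contraction Ds Dq.
pose S := (4 * s) *: D - (2^-1 * s) *: (D *m D).
pose b := (2 * s) *: (D *m nu) - (2^-1 * s) *: (D *m D *m nu).
have DDs : (D *m D)^T = D *m D by rewrite trmx_mul Ds.
have := @expectation_expR_quadratic S b
  (- (2 * s * \tr D) - 4^-1 * s * dot (D *m nu) (D *m nu)).
have -> : S^T = S by rewrite /S linearB/= !linearZ/= Ds DDs.
move=> /(_ erefl).
have cond (v : 'cV_n) : dot v (S *m v) <= 2^-1 * dot v v.
  rewrite /S mulmxBl -!scalemxAl dotBr !dotZr -mulmxA (dot_mulmx v D (D *m v)) Ds.
  have := Dq v; rewrite ler_norml qformE => /andP[_].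
  have := dot_ge0 v; have := dot_ge0 (D *m v); nra.
move=> /(_ cond) H; apply: le_trans (le_trans H _); last first.
  rewrite lee_fin ler_expR.
  have := frob2B_le ((4 * s) *: D) ((2^-1 * s) *: (D *m D)).
  have := dotBB_le ((2 * s) *: (D *m nu)) ((2^-1 * s) *: (D *m D *m nu)).
  rewrite -/S -/b /S linearB/= !mxtraceZ -(frob2_sym Ds) !frob2Z !dotZl !dotZr.
  have := frob2_mulmx_le D Dc; rewrite -(mulmxA D D nu); have := Dc (D *m nu).
  rewrite /msq; have := frob2_ge0 D; have := frob2_ge0 (D *m D).
  have := dot_ge0 (D *m nu); have := dot_ge0 (D *m (D *m nu)).
  move: (frob2 D) (frob2 (D *m D)) (frob2 _) (dot b b) => f1 f2 f3 bb.
  move: (dot (D *m nu) _) (dot (D *m (D *m nu)) _) => a1 a2 a2_ge0 a1_ge0.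
  move=> f2_ge0 f1_ge0 a21 f21 hb hf.
  have ss : s ^+ 2 <= 264^-1 * s by rewrite expr2 ler_wpM2r.
  have := ler_wpM2r f1_ge0 ss; have := ler_wpM2r a1_ge0 ss.
  have := ler_wpM2l (sqr_ge0 s) f21; have := ler_wpM2l (sqr_ge0 s) a21.
  have := mulr_ge0 s_ge0 f1_ge0; have := mulr_ge0 s_ge0 a1_ge0.
  move: hb hf; rewrite !exprMn; lra.
rewrite le_eqVlt; apply/orP; left; apply/eqP; apply: eq_integral => w _.
congr (expR _)%:E; rewrite gproc_quadratic// nproc_quadratic//.
rewrite /S /b mulmxBl -!scalemxAl dotBr dotBl !dotZr !dotZl; by field.
Qed.

Lemma measurable_gproc D : measurable_fun setT (fun w => gproc D (gvec sigma X w)).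
Proof.
have mg := measurable_gvec sigma X.
apply: measurable_funB => //; apply: measurable_dot => //.
apply: measurable_mxM; first exact: measurable_mx_cst.
by apply: measurable_mxD => //; exact: measurable_mx_cst.
Qed.

Lemma measurable_nproc D : measurable_fun setT (fun w => nproc D (gvec sigma X w)).
Proof.
have mg := measurable_gvec sigma X.
by apply: measurable_dot; (apply: measurable_mxM; first exact: measurable_mx_cst);
  apply: measurable_mxD => //; exact: measurable_mx_cst.
Qed.

End GaussianChaos.

(** * Chaining *)

Section Envelope.
Context d (T : measurableType d) {R : realType} (P : probability T R).

(* An outer-expectation bound for the supremum of a family of functions. *)
Definition has_envelope (F : set (T -> R)) (K : R) :=
  exists W : T -> R, [/\ measurable_fun setT W, forall w, 0 <= W w,
    (\int[P]_w (W w)%:E <= K%:E)%E & forall f w, F f -> f w <= W w].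

Lemma integral_probability_cst (c : R) : (\int[P]_w c%:E = c%:E)%E.
Proof.
by rewrite integral_cst// (_ : _ [set: T] = 1%E) ?mule1//; exact: probability_setT.
Qed.

Lemma has_envelope_fun (f : T -> R) K : measurable_fun setT f ->
  (forall w, 0 <= f w) -> (\int[P]_w (f w)%:E <= K%:E)%E ->
  has_envelope [set f] K.
Proof. by move=> mf f0 fK; exists f; split=> // g w ->. Qed.

Lemma has_envelope_cst c : 0 <= c -> has_envelope [set (fun=> c)] c.
Proof. by move=> c0; apply: has_envelope_fun; rewrite ?integral_probability_cst. Qed.

Lemma has_envelope0 : has_envelope set0 0.
Proof. by exists (fun=> 0); split=> //; rewrite integral_probability_cst. Qed.

Lemma has_envelope_le (F G : set (T -> R)) K L :
  has_envelope G L -> L <= K ->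
  (forall f w, F f -> exists2 g, G g & f w <= g w) -> has_envelope F K.
Proof.
move=> [W [mW W0 WL GW]] LK FG; exists W; split=> //.
  by apply: le_trans WL _; rewrite lee_fin.
by move=> f w /(FG f w)[g Gg /le_trans]; apply; exact: GW.
Qed.

Lemma has_envelopeD (F G : set (T -> R)) K L :
  has_envelope F K -> has_envelope G L ->
  has_envelope [set f | exists f1 f2, [/\ F f1, G f2 & f = f1 \+ f2]] (K + L).
Proof.
move=> [W1 [mW1 W10 W1K FW1]] [W2 [mW2 W20 W2L GW2]].
exists (W1 \+ W2); split=> [|w||].
- exact: measurable_funD.
- exact: addr_ge0.
- under eq_integral do rewrite EFinD.
  rewrite ge0_integralD//; last 4 first.
  - by move=> w _; rewrite lee_fin.
  - exact/measurable_EFinP.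
  - by move=> w _; rewrite lee_fin.
  - exact/measurable_EFinP.
  by rewrite EFinD leeD.
- by move=> _ w [f1 [f2 [/FW1 h1 /GW2 h2 ->]]]; exact: lerD.
Qed.

(** The union bound: the dominating functions are nonnegative, so their sum dominates both
    families. *)
Lemma has_envelopeU (F G : set (T -> R)) K L :
  has_envelope F K -> has_envelope G L -> has_envelope (F `|` G) (K + L).
Proof.
move=> [W1 [mW1 W10 W1K FW1]] [W2 [mW2 W20 W2L GW2]].
have [W [mW W0 WKL DW]] : has_envelope [set W1 \+ W2] (K + L).
  apply: (has_envelope_le (has_envelopeD (has_envelope_fun mW1 W10 W1K)
    (has_envelope_fun mW2 W20 W2L))) => // _ w ->.
  by exists (W1 \+ W2) => //; exists W1, W2.
exists W; split=> // f w [/FW1|/GW2] /(_ w) h; apply: (le_trans h);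
  apply: le_trans (DW (W1 \+ W2) w erefl); rewrite /= ?lerDl ?lerDr//.
Qed.

Lemma has_envelopeZ (F : set (T -> R)) K c : 0 <= c -> has_envelope F K ->
  has_envelope [set f | exists2 g, F g & f = (fun w => c * g w)] (c * K).
Proof.
move=> c0 [W [mW W0 WK FW]]; exists (fun w => c * W w); split.
- exact: measurable_funM.
- by move=> w; rewrite mulr_ge0.
- under eq_integral do rewrite EFinM.
  rewrite ge0_integralZl//; last 2 first.
  - exact/measurable_EFinP.
  - by move=> w _; rewrite lee_fin.
  by rewrite EFinM lee_wpmul2l.
- by move=> _ w [g Fg ->]; rewrite ler_wpM2l// FW.
Qed.

Lemma has_envelope_bigcup (I : finType) (F : I -> set (T -> R)) K :
  (forall i, has_envelope (F i) (K i)) ->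
  has_envelope (\bigcup_i F i) (\sum_i K i).
Proof.
move=> FK; rewrite (_ : \bigcup_i F i = \big[setU/set0]_(i <- index_enum I) F i).
  elim: (index_enum I) => [|i r IH]; first by rewrite !big_nil; exact: has_envelope0.
  by rewrite !big_cons; exact: has_envelopeU.
rewrite -bigcup_seq; congr bigcup; apply/seteqP; split=> i //= _.
by rewrite mem_index_enum.
Qed.

End Envelope.

(** The tangent of exp at the weighted mean lies below exp at both points. *)
Lemma expR_convex2 (R : realType) (w a b : R) : 0 <= w <= 1 ->
  expR ((1 - w) * a + w * b) <= (1 - w) * expR a + w * expR b.
Proof.
move=> /andP[w0 w1]; set m := (1 - w) * a + w * b.
have tangent x : expR m * (1 + (x - m)) <= expR x.
  have -> : expR x = expR m * expR (x - m) by rewrite -expRD; congr expR; ring.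
  by rewrite ler_wpM2l ?expR_ge0// expR_ge1Dx.
have ha := ler_wpM2l (_ : 0 <= 1 - w) (tangent a).
have hb := ler_wpM2l w0 (tangent b).
have w1' : 0 <= 1 - w by rewrite subr_ge0.
apply: le_trans (lerD (ha w1') hb); rewrite le_eqVlt; apply/orP; left.
by apply/eqP; rewrite /m; ring.
Qed.

Lemma expr2n_le_expR (R : realType) k : 2 ^+ k <= expR k%:R :> R.
Proof.
rewrite -[k%:R]mulr1 expRM_natl lerXn2r ?nnegrE ?expR_ge0//.
by have := expR_ge1Dx (1 : R); rewrite -natr1.
Qed.

(** * Chaining over a subset of the unit interval *)

Section Chaining.
Context d (T : measurableType d) {R : realType} (P : probability T R).
Context {I : finType} (S : {set I}) (a : I) (t : I -> R) (G : I -> T -> R).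
Variable K0 : R.
Hypotheses (aS : a \in S) (t01 : forall i, i \in S -> 0 <= t i < 1).
Hypothesis mG : forall i, measurable_fun setT (G i).
Hypothesis K0_ge0 : 0 <= K0.
Hypothesis incr : forall i j r, i \in S -> j \in S ->
  16 * r ^+ 2 * `|t i - t j| <= 1 ->
  (\int[P]_w (expR (r * (G i w - G j w)))%:E <= K0%:E)%E.

Let net N : (0 < N)%N -> exists s : seq I, [/\ (size s <= N)%N,
  {subset s <= S} &
  forall i, i \in S -> exists2 p, p \in s & `|t i - t p| <= N%:R^-1].
Proof.
move=> N0; have N0' : 0 < N%:R :> R by rewrite ltr0n.
(* One representative for each of the N subintervals of length 1/N; the default [a] fills the empty
   ones and keeps the list inside [S]. *)
pose rep m := odflt a [pick i in S | Num.truncn (N%:R * t i) == m].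
exists [seq rep m | m <- iota 0 N]; split.
- by rewrite size_map size_iota.
- by move=> _ /mapP[m _ ->]; rewrite /rep; case: pickP => //= i /andP[].
- move=> i iS; set m := Num.truncn (N%:R * t i); exists (rep m).
    apply: map_f; rewrite mem_iota add0n /m -(ltr_nat R).
    have /andP[ti0 ti1] := t01 iS.
    apply: (@le_lt_trans _ _ (N%:R * t i)); last by rewrite gtr_pMr.
    by rewrite truncn_le mulr_ge0// ltW.
  rewrite /rep; case: pickP => [p /andP[pS /eqP pm]|/(_ i)]; last first.
    by rewrite iS /m eqxx.
  have /andP[ti0 ti1] := t01 iS; have /andP[tp0 tp1] := t01 pS.
  have := truncn_itv (mulr_ge0 (ltW N0') ti0); rewrite -/m => /andP[i1 i2].
  have := truncn_itv (mulr_ge0 (ltW N0') tp0); rewrite pm => /andP[p1 p2].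
  rewrite -(ler_pM2l N0') divff ?gt_eqF// -[X in X * _](gtr0_norm N0') -normrM.
  rewrite mulrBr ler_norml; move: i1 i2 p1 p2; rewrite -[m.+1%:R]natr1; lra.
Qed.

(* At level [l] the net has mesh [2^-l], so its increments have exponential
   moments at rate [2^(l/2)]; any [rho] in (2^(-1/2), 1) lets the convexity
   weights decay geometrically while [weight l] absorbs the [ln 2^(l+1)] of the
   union bound: [bound l] solves
   [bound (l + 1) = exp (rho ^ l * (l + 1) / 4) * bound l]. *)
Let rho : R := 3 / 4.
Let theta l : R := 128^-1 * (1 + rho ^+ l).
Let weight l : R := rho ^+ l / (4 * (1 + rho ^+ l)).
Let bound l : R := K0 * expR (4 - rho ^+ l * (l%:R + 4)).
Let incrs (th : R) (s : seq I) : set (T -> R) :=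
  [set (fun w => expR (th * (G i w - G a w))) | i in [set` s]].

Let rho_gt0 l : 0 < rho ^+ l.
Proof. by rewrite exprn_gt0// /rho. Qed.

Let rho_le1 l : rho ^+ l <= 1.
Proof. by rewrite exprn_ile1// /rho; lra. Qed.

Let rho_l l : rho ^+ l * (l%:R + 4) <= 4.
Proof.
elim: l => [|l IH]; first by rewrite expr0 mul1r add0r.
apply: le_trans IH; rewrite exprSr -mulrA ler_wpM2l ?(ltW (rho_gt0 l))//.
have l0 : 0 <= l%:R :> R by rewrite ler0n.
by rewrite -[l.+1%:R]natr1 /rho; lra.
Qed.

Let mexp i j r : measurable_fun setT (fun w => expR (r * (G i w - G j w))).
Proof.
apply: measurableT_comp => //; apply: measurable_funM => //.
exact: measurable_funB.
Qed.

Let sum_envelope (s : seq I) (q : I -> I) r :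
  {subset s <= S} -> (forall i, i \in s -> q i \in S) ->
  (forall i, i \in s -> 16 * r ^+ 2 * `|t i - t (q i)| <= 1) ->
  has_envelope P [set (fun w => expR (r * (G i w - G (q i) w))) | i in [set` s]]
    ((size s)%:R * K0).
Proof.
move=> sS qS qt.
have -> : (size s)%:R * K0 = \sum_(i <- s) K0.
  by rewrite big_const_seq count_predT iter_addr_0 mulr_natl.
elim: s sS qS qt => [|i s IH] sS qS qt.
  rewrite big_nil; apply: (has_envelope_le (has_envelope0 P)) => // f w [].
  by [].
rewrite big_cons.
have is0 : i \in i :: s by rewrite mem_head.
have h1 := has_envelope_fun (mexp i (q i) r) (fun w => expR_ge0 _)
   (incr (sS _ is0) (qS _ is0) (qt _ is0)).
have sub j : j \in s -> j \in i :: s by move=> js; rewrite in_cons js orbT.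
have h2 := IH (fun j js => sS _ (sub _ js)) (fun j js => qS _ (sub _ js))
  (fun j js => qt _ (sub _ js)).
apply: (has_envelope_le (has_envelopeU h1 h2)) => // f w [j /= + <-].
rewrite in_cons => /orP[/eqP ->|js]; first by eexists; [left|].
by eexists; [right; exists j|].
Qed.

(** By induction on l. Each point i is linked to a parent in a net of at most 2^l points; convexity
    of exp with weight w separates the parent term, covered by the induction hypothesis, from the
    link term, covered by a union bound over s. *)
Let chaining_step l s : {subset s <= S} -> (size s <= 2 ^ l)%N ->
  has_envelope P (incrs (theta l) s) (bound l).
Proof.
elim: l s => [|l IH] s sS ssize.
  have : has_envelope P (incrs (theta 0) s) ((size s)%:R * K0).
    apply: sum_envelope => // i /sS iS; rewrite /theta expr0.
    have /andP[ti0 ti1] := t01 iS; have /andP[ta0 ta1] := t01 aS.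
    have : `|t i - t a| <= 1 by rewrite ler_norml; lra.
    have := normr_ge0 (t i - t a); lra.
  move=> h; apply: (has_envelope_le h) => [|f w Ff]; last by exists f.
  rewrite /bound expr0 mul1r add0r subrr expR0 mulr1.
  by rewrite ler_piMl// (@ler_nat _ _ 1).
have [N [Nsize NS Nnet]] := net (expn_gt0 2 l).
have {IH} hN := IH N NS Nsize.
have par_ex i : exists p, i \in s -> p \in N /\ `|t i - t p| <= (2 ^ l)%:R^-1.
  have [/sS/Nnet[p pN tp]|] := boolP (i \in s); first by exists p.
  by exists a.
have {par_ex}[par parP] := choice par_ex.
have r0 := rho_gt0 l; have r1 := rho_le1 l.
set r := rho ^+ l in r0 r1.
set w := weight l.
have wE : w = r / (4 * (1 + r)) by [].
have r1p : 0 < 1 + r by lra.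
have w0 : 0 < w by rewrite wE divr_gt0// mulr_gt0.
have wr : w <= r / 4.
  by rewrite wE invfM mulrA ler_piMr ?divr_ge0 ?(ltW r0)// invf_le1//; lra.
have w1 : w < 1 by lra.
have thE : theta l.+1 = (1 - w) * theta l.
  by rewrite /theta exprS -/r wE /rho; field; rewrite gt_eqF.
(* The shift exp (- c) pays for the at most 2^(l+1) <= e^c link terms; its price is the factor exp
   (w c). *)
pose c := (l.+1%:R : R).
have hpar : has_envelope P
    [set (fun x => expR (theta l.+1 / w * (G i x - G (par i) x))) | i in [set` s]]
    ((size s)%:R * K0).
  apply: sum_envelope => // i iS; have [pN tp] := parP i iS; first exact: NS.
  (* The links are at distance at most 2^-l <= (9/16)^l = r^2, so a rate of 1/(8 r) gives 16 .
     rate^2 . distance <= 1/4 and [incr] applies. *)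
  have tw : theta l.+1 / w <= 8^-1 / r.
    rewrite (_ : theta l.+1 / w = 32^-1 * (1 + 3 / 4 * r) * (1 + r) / r).
      by rewrite ler_pM2r ?invr_gt0//; nra.
    by rewrite /theta exprS -/r wE /rho; field; rewrite !gt_eqF.
  have tw0 : 0 <= theta l.+1 / w.
    rewrite divr_ge0 ?(ltW w0)// /theta mulr_ge0// addr_ge0// ltW//.
  have r2 : (2 ^ l)%:R^-1 <= r ^+ 2.
    rewrite natrX -exprVn /r exprAC.
    by apply: lerXn2r; rewrite ?nnegrE ?sqr_ge0// /rho; lra.
  apply: (@le_trans _ _ (16 * (8^-1 / r) ^+ 2 * r ^+ 2)).
    apply: ler_pM => //; first by rewrite mulr_ge0// sqr_ge0.
    - by rewrite ler_wpM2l// lerXn2r// nnegrE (le_trans tw0).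
    - exact: le_trans tp r2.
  rewrite expr_div_n -mulrA divfK ?sqrf_eq0 ?gt_eqF//; lra.
have ew0 : 0 <= expR (w * c) by exact: expR_ge0.
have h1 : 0 <= expR (w * c) * (1 - w) by rewrite mulr_ge0// subr_ge0 ltW.
have h2 : 0 <= expR (w * c) * w * expR (- c).
  exact: mulr_ge0 (mulr_ge0 ew0 (ltW w0)) (expR_ge0 _).
have := has_envelopeD (has_envelopeZ h1 hN) (has_envelopeZ h2 hpar).
move=> h; apply: (has_envelope_le h) => [|f x [i /= iS <-]].
  have sc : (size s)%:R <= expR c.
    apply: le_trans (expr2n_le_expR R l.+1).
    by rewrite -natrX ler_nat.
  have bK : K0 <= bound l.
    rewrite /bound; apply: ler_peMr => //; rewrite -[leLHS]expR0 ler_expR subr_ge0.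
    exact: rho_l.
  have -> : bound l.+1 = expR (4^-1 * r * c) * bound l.
    rewrite /bound mulrCA -expRD; congr (_ * expR _).
    by rewrite exprS -/r /c /rho -natr1; field.
  apply: (@le_trans _ _ (expR (w * c) * bound l)); last first.
    rewrite ler_wpM2r ?(le_trans K0_ge0)// ler_expR ler_wpM2r ?ler0n//.
    by rewrite mulrC.
  have q : expR (- c) * ((size s)%:R * K0) <= bound l.
    apply: le_trans bK; rewrite mulrA ler_piMl//.
    by rewrite expRN mulrC ler_pdivrMr ?expR_gt0// mul1r.
  rewrite [leRHS](_ : _ = expR (w * c) * (1 - w) * bound l
    + expR (w * c) * w * bound l); last by move: (bound l) => b; ring.
  rewrite lerD2l -(mulrA (expR (w * c) * w)).
  by apply: ler_wpM2l => //; exact: mulr_ge0 ew0 (ltW w0).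
have [pN _] := parP i iS.
exists (fun x => expR (w * c) * (1 - w) * expR (theta l * (G (par i) x - G a x))
  + expR (w * c) * w * expR (- c)
    * expR (theta l.+1 / w * (G i x - G (par i) x))).
  eexists; eexists; split; last by [].
  - by eexists; [exists (par i)|].
  - by eexists; [exists i|].
set A := theta l * (G (par i) x - G a x).
set B := theta l.+1 / w * (G i x - G (par i) x).
have -> : theta l.+1 * (G i x - G a x) = w * c + ((1 - w) * A + w * (B - c)).
  rewrite /A /B thE; field; rewrite gt_eqF//.
have w01 : 0 <= w <= 1 by rewrite (ltW w0) (ltW w1).
rewrite expRD; apply: le_trans (ler_wpM2l ew0 (expR_convex2 A (B - c) w01)) _.
rewrite expRD le_eqVlt; apply/orP; left; apply/eqP.
by rewrite mulrDr -!mulrA (mulrC (expR B)).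
Qed.

(** At level #|S| the list can be all of [S], as #|S| < 2^#|S|. There the rate still exceeds 1/128:
    lowering it is harmless where the increment is nonnegative, and elsewhere the exponential is at
    most 1, hence the summand 1. *)
Lemma chaining : has_envelope P
  [set (fun w => expR (128^-1 * (G i w - G a w))) | i in [set` S]]
  (K0 * expR 4 + 1).
Proof.
have h : has_envelope P (incrs (theta #|S|) (enum S)) (bound #|S|).
  apply: chaining_step => [i|]; first by rewrite mem_enum.
  by rewrite -cardE ltnW// ltn_expl.
have hD := has_envelopeD h (has_envelope_cst P (@ler01 R)).
apply: (has_envelope_le hD).
  rewrite lerD2r /bound ler_wpM2l// ler_expR gerBl.
  by apply: mulr_ge0; [exact: ltW|exact: addr_ge0].
move=> _ w [i /= iS <-].
exists (fun w => expR (theta #|S| * (G i w - G a w)) + 1).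
  by eexists; eexists; split; [exists i; rewrite //= mem_enum|by []|].
set z := G i w - G a w; have r0 := rho_gt0 #|S|.
have th : 128^-1 <= theta #|S| by rewrite /theta ler_peMr// lerDl ltW.
have [z0|z0] := leP 0 z.
  by rewrite ler_wpDr// ler_expR ler_wpM2r.
by rewrite ler_wpDl ?expR_ge0// -expR0 ler_expR mulr_ge0_le0// ltW.
Qed.

End Chaining.

(** * Ordered smoothers *)

Section OrderedSmoothers.
Context {R : realType} {n : nat}.
Implicit Types (A B C : 'M[R]_n) (F : set 'M[R]_n) (u : 'cV[R]_n).

Definition increment_superadditive (A B C : 'M[R]_n) := forall u : 'cV[R]_n,
  dot ((B - A) *m u) ((B - A) *m u) + dot ((C - B) *m u) ((C - B) *m u)
  <= dot ((C - A) *m u) ((C - A) *m u).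

Lemma increment_superadditive_rev A B C :
  increment_superadditive A B C -> increment_superadditive C B A.
Proof.
move=> h u; have := h u.
have opp (D E : 'M[R]_n) : dot ((D - E) *m u) ((D - E) *m u)
    = dot ((E - D) *m u) ((E - D) *m u).
  by rewrite -[D - E]opprB mulNmx dotNl dotNr opprK.
by rewrite (opp B A) (opp C B) (opp C A) addrC.
Qed.

Lemma smoother_sym F A : ordered_linear_smoothers F -> F A -> A^T = A.
Proof. by move=> [_ h _ _] /h[]. Qed.

Lemma smoother_qform F A u : ordered_linear_smoothers F -> F A ->
  0 <= qform A u <= dot u u.
Proof. by move=> [_ h _ _] /h[_ /(_ u)]; rewrite enorm_sqr. Qed.

(** C - A is the sum of the commuting positive matrices B - A <= 1 and C - B, so the cross term <(B
    - A) u, (C - B) u> is nonnegative by [comm_psd_mul]. *)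
Lemma smoother_superadditive F A B C :
  ordered_linear_smoothers F -> F A -> F B -> F C ->
  loewner_le A B -> loewner_le B C -> increment_superadditive A B C.
Proof.
move=> oF FA FB FC AB BC u; have [_ _ comm _] := oF.
have BAs : (B - A)^T = B - A.
  by rewrite linearB/= (smoother_sym oF FB) (smoother_sym oF FA).
have := @comm_psd_mul _ _ (B - A) (C - B) u BAs.
have le1 w : 0 <= qform (B - A) w <= dot w w.
  have [_ ->] := AB; rewrite /= qformB.
  have /andP[_ Bw] := smoother_qform w oF FB.
  have /andP[Aw _] := smoother_qform w oF FA.
  by rewrite lerBlDr (le_trans Bw)// lerDl.
move=> /(_ le1 BC).
have cm : (B - A) *m (C - B) = (C - B) *m (B - A).
  rewrite !mulmxBl !mulmxBr (comm _ _ FB FC) (comm _ _ FA FC) (comm _ _ FA FB).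
  by rewrite !opprB addrACA [RHS]addrACA (addrC (- (B *m B))).
move=> /(_ cm) h.
rewrite (_ : C - A = (B - A) + (C - B)); last by rewrite [RHS]addrC subrKA.
rewrite (mulmxDl (B - A)) (dotDD ((B - A) *m u)); lra.
Qed.

Lemma smoother_diff_contraction F G A B :
  ordered_linear_smoothers F -> ordered_linear_smoothers G -> F A -> G B ->
  forall u, `|qform (A - B) u| <= dot u u.
Proof.
move=> oF oG FA GB u; have := smoother_qform u oF FA; have := smoother_qform u oG GB.
by rewrite qformB ler_norml => /andP[h1 h2] /andP[h3 h4]; apply/andP; split; lra.
Qed.

End OrderedSmoothers.

(** * Potentials along a chain, with [r] the Loewner order or its converse *)

Section OrderedChain.
Context {R : realType} {n M : nat}.
Variables (A : 'I_M -> 'M[R]_n) (r : 'M[R]_n -> 'M[R]_n -> Prop) (B : 'M[R]_n).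
Variables (S : {set 'I_M}) (nu : 'cV[R]_n).
Hypothesis rB : forall i, i \in S -> r B (A i).
Hypothesis rtot : forall i j, i \in S -> j \in S -> r (A i) (A j) \/ r (A j) (A i).
Hypothesis superB : forall i j, i \in S -> j \in S -> r (A i) (A j) ->
  increment_superadditive B (A i) (A j).
Hypothesis super : forall i j k, i \in S -> j \in S -> k \in S ->
  r (A i) (A j) -> r (A j) (A k) -> increment_superadditive (A i) (A j) (A k).

Definition potential i := msq nu (A i - B).

Let potential_mono i j : i \in S -> j \in S -> r (A i) (A j) ->
  msq nu (A j - A i) <= potential j - potential i.
Proof.
move=> iS jS rij; rewrite lerBrDl; apply: msq_addr; exact: superB.
Qed.

Lemma msq_le_potential i j : i \in S -> j \in S ->
  msq nu (A i - A j) <= `|potential i - potential j|.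
Proof.
move=> iS jS; have [|] := rtot iS jS => /potential_mono.
- by rewrite msqC distrC => /(_ iS jS) h; rewrite (le_trans h)// ler_norm.
- by move=> /(_ jS iS) h; rewrite (le_trans h)// ler_norm.
Qed.

Let potential_eq i j : i \in S -> j \in S -> r (A i) (A j) ->
  potential j <= potential i -> A j = A i.
Proof.
move=> iS jS rij le; apply/eqP; rewrite -subr_eq0; apply/eqP.
by apply: (@msq_le0 _ _ nu); rewrite (le_trans (potential_mono iS jS rij))// subr_le0.
Qed.

(** Sorting by potential agrees with [r] up to equal matrices: where the two orders disagree,
    [potential_eq] identifies the matrices. *)
Lemma potential_between i j k u : i \in S -> j \in S -> k \in S ->
  potential i <= potential j <= potential k ->
  dot ((A j - A i) *m u) ((A j - A i) *m u)
  <= dot ((A k - A i) *m u) ((A k - A i) *m u).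
Proof.
move=> iS jS kS /andP[ij jk].
have [rij|rji] := rtot iS jS; last first.
  by rewrite (potential_eq jS iS rji ij) subrr mul0mx dot0l dot_ge0.
have [rjk|rkj] := rtot jS kS; last by rewrite (potential_eq kS jS rkj jk).
by apply: le_trans (super iS jS kS rij rjk u); rewrite lerDl dot_ge0.
Qed.

End OrderedChain.

(** In order: the drift s/8 of [expectation_expR_center] at s = 1/512, the quarter of it that is
    kept in a cell, and the factor in T_j <= 4 [msq nu (A j - Ak)]. *)
Definition cell_rate {R : realType} : R := 512^-1 / 8 / 4 / 4.
(** Weights 1/2, 1/4, 1/4 on the center, on the chaining bound for increment moments e^(1/4), and on
    the width of the cell. *)
Definition cell_const {R : realType} : R :=
  2^-1 + 4^-1 * (expR 4^-1 * expR 4 + 1) + 4^-1 * expR 2^-1.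
Definition family_const {R : realType} : R :=
  2 * (cell_const / (1 - expR (- cell_rate))).

Lemma cell_const_ge0 {R : realType} : 0 <= cell_const :> R.
Proof.
rewrite /cell_const !addr_ge0// mulr_ge0// ?addr_ge0// ?mulr_ge0 ?expR_ge0//.
Qed.

Lemma expR_cell_rate_lt1 {R : realType} : expR (- cell_rate) < 1 :> R.
Proof. by rewrite -[ltRHS]expR0 ltr_expR oppr_lt0 /cell_rate; lra. Qed.

Lemma sum_geometric_le {R : realType} (r : R) N : 0 <= r < 1 ->
  \sum_(m < N) r ^+ m <= (1 - r)^-1.
Proof.
move=> /andP[r0 r1]; have r1' : 0 < 1 - r by rewrite subr_gt0.
rewrite -[leRHS]mul1r ler_pdivlMr// mulrC -opprB mulNr -subrX1 opprB.
by rewrite gerBl exprn_ge0.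
Qed.

Lemma dist_le1 {R : realType} (m x y : R) :
  m <= x < m + 1 -> m <= y < m + 1 -> `|x - y| <= 1.
Proof.
by move=> /andP[x1 x2] /andP[y1 y2]; rewrite ler_norml; apply/andP; split; lra.
Qed.

Lemma expR_half_convex {R : realType} (a b : R) :
  expR (2^-1 * a + 2^-1 * b) <= 2^-1 * expR a + 2^-1 * expR b.
Proof.
have h : 1 - 2^-1 = 2^-1 :> R by field.
have := @expR_convex2 R 2^-1 a b; rewrite h; apply.
by apply/andP; split; lra.
Qed.

Lemma family_const_ge0 {R : realType} : 0 <= family_const :> R.
Proof.
rewrite /family_const mulr_ge0// divr_ge0 ?cell_const_ge0// subr_ge0.
by rewrite ltW// expR_cell_rate_lt1.
Qed.

(** * Envelopes over a cell, a side, a family and the union of the families *)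

Section Envelopes.
Context d (T : measurableType d) {R : realType} (P : probability T R).
Context {n M : nat} (sigma : R) (X : 'I_n -> {RV P >-> R}) (nu : 'cV[R]_n).
Hypotheses (gX : isotropic_gaussian sigma X) (s0 : 0 < sigma).
Variables (A : 'I_M -> 'M[R]_n) (Ak : 'M[R]_n).
Local Notation x w := (gvec sigma X w).

Definition penalized D w :=
  2 * gproc nu D (x w) - 2^-1 * nproc nu D (x w).

Definition exp_penalized (j : 'I_M) : T -> R :=
  fun w => expR (1024^-1 * penalized (A j - Ak) w).

(** From |D u|^2 <= 2 |(D + E) u|^2 + 2 |E u|^2: half of the negative square is kept for D, at the
    cost of a positive square of E. Bounding that one by F lets a single matrix serve a whole
    cell. *)
Lemma penalized_split D E F w : nproc nu E (x w) <= nproc nu F (x w) ->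
  penalized (D + E) w <= (2 * gproc nu D (x w) - 4^-1 * nproc nu D (x w))
    + 2 * gproc nu E (x w) + 2^-1 * nproc nu F (x w).
Proof.
move=> EF; rewrite /penalized gprocD.
have : nproc nu D (x w) <= 2 * nproc nu (D + E) (x w) + 2 * nproc nu E (x w).
  rewrite -[X in nproc nu X _ <= _](addrK E) /nproc mulmxBl.
  exact: dotBB_le.
lra.
Qed.

Section Cell.
Variables (S : {set 'I_M}) (B : 'M[R]_n).
Let pot := potential A B nu.
Hypothesis As : forall j, j \in S -> (A j)^T = A j.
Hypothesis Aks : Ak^T = Ak.
Hypothesis contr : forall j, j \in S ->
  forall v : 'cV_n, `|qform (A j - Ak) v| <= dot v v.
Hypothesis msq_pot : forall i j, i \in S -> j \in S ->
  msq nu (A i - A j) <= `|pot i - pot j|.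
Hypothesis between : forall i j k (u : 'cV_n), i \in S -> j \in S -> k \in S ->
  pot i <= pot j <= pot k ->
  dot ((A j - A i) *m u) ((A j - A i) *m u)
  <= dot ((A k - A i) *m u) ((A k - A i) *m u).
Hypothesis near : forall j, j \in S -> msq nu (B - Ak) <= msq nu (A j - Ak).

Let diff_sym i j : i \in S -> j \in S -> (A i - A j)^T = A i - A j.
Proof. by move=> iS jS; rewrite linearB/= !As. Qed.

(* With [a] and [b] the lowest and highest points of the cell,
   [A j - Ak = (A a - Ak) + (A j - A a)]: the first summand carries the drift,
   the second is handled by chaining, and [nproc] is monotone along the cell. *)
Lemma cell_envelope m :
  has_envelope P [set exp_penalized j | j in
      [set` [set j in S | Num.truncn (pot j) == m]%SET]]
    (cell_const * expR (- cell_rate) ^+ m).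
Proof.
set C := [set j in S | _]%SET.
have pot_ge0 j : 0 <= pot j by exact: msq_ge0.
have C_itv j : j \in C -> m%:R <= pot j < m%:R + 1.
  rewrite inE => /andP[_ /eqP <-]; have := truncn_itv (pot_ge0 j).
  by rewrite natr1.
have CS j : j \in C -> j \in S by rewrite inE => /andP[].
have [C0|[j0 j0C]] := set_0Vmem C.
  apply: (has_envelope_le (has_envelope0 P)).
    by rewrite mulr_ge0 ?cell_const_ge0// exprn_ge0// expR_ge0.
  by move=> f w [j /=]; rewrite C0 inE.
pose a := [arg min_(j < j0 in C) pot j]%O; pose b := [arg max_(j > j0 in C) pot j]%O.
have [aC amin] : a \in C /\ forall j, j \in C -> pot a <= pot j.
  by rewrite /a; case: arg_minP => // i iC imin; split.
have [bC bmax] : b \in C /\ forall j, j \in C -> pot j <= pot b.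
  by rewrite /b; case: arg_maxP => // i iC imax; split.
pose D := A a - Ak.
(* T_a <= 2 [msq nu D] + 2 [msq nu (Ak - B)], and the last term is at most 2 [msq nu D] because [B]
   is at least as near to [Ak]. *)
have mD : m%:R <= 4 * msq nu D.
  have /andP[ma _] := C_itv _ aC; apply: (le_trans ma).
  rewrite /pot /potential (_ : A a - B = D + (Ak - B)); last by rewrite subrKA.
  have := msqD_le nu D (Ak - B); have := near (CS _ aC); rewrite msqC -/D; lra.
pose t j := pot j - m%:R.
have chain : has_envelope P
   [set (fun w => expR (128^-1 * (gproc nu (A i) (x w) - gproc nu (A a) (x w))))
    | i in [set` C]] (expR 4^-1 * expR 4 + 1).
  apply: (@chaining _ _ _ P _ C a t (fun i w => gproc nu (A i) (x w))) => //.
  - by move=> i /C_itv; rewrite /t; lra.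
  - by move=> i; exact: measurable_gproc.
  - move=> i j r iC jC rt.
    under eq_integral do rewrite -gprocB.
    apply: expectation_expR_gproc => //; first exact: diff_sym (CS _ iC) (CS _ jC).
    apply: le_trans rt; apply: ler_wpM2l.
      by apply: mulr_ge0 => //; exact: sqr_ge0.
    apply: le_trans (msq_pot (CS _ iC) (CS _ jC)) _.
    by rewrite /t opprB addrA subrK.
pose kappa := 512^-1 / 8 * msq nu D.
have Ds : D^T = D by rewrite /D linearB/= Aks As// CS.
have center : has_envelope P
   [set (fun w => expR (512^-1 * (2 * gproc nu D (x w) - 4^-1 * nproc nu D (x w))))]
   (expR (- kappa)).
  apply: has_envelope_fun; [|by move=> w; exact: expR_ge0|].
    apply: measurableT_comp; first exact: measurable_expR.
    apply: measurable_funM; first exact: measurable_cst.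
    apply: measurable_funB; (apply: measurable_funM; first exact: measurable_cst).
      exact: measurable_gproc.
    exact: measurable_nproc.
  apply: (expectation_expR_center gX s0) => //; last by lra.
  exact: contr (CS _ aC).
have width : has_envelope P
   [set (fun w => expR (512^-1 * nproc nu (A b - A a) (x w)))] (expR 2^-1).
  apply: has_envelope_fun; [|by move=> w; exact: expR_ge0|].
    apply: measurableT_comp; first exact: measurable_expR.
    apply: measurable_funM; first exact: measurable_cst.
    exact: measurable_nproc.
  apply: (expectation_expR_nproc gX s0) => //; last by lra.
    exact: diff_sym (CS _ bC) (CS _ aC).
  apply: (le_trans (msq_pot (CS _ bC) (CS _ aC))).
  exact: dist_le1 (C_itv _ bC) (C_itv _ aC).
(* A factor exp (- kappa / 4) is set aside for the geometric decay. The center then carries exp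
   (kappa / 2), which its moment exp (- kappa) absorbs. Chaining and width share the other half of
   the exponent, hence 1/4 each. *)
have ek0 : 0 <= expR (- (kappa / 4)) by exact: expR_ge0.
have c1 : 0 <= 2^-1 * expR (kappa / 2) by rewrite mulr_ge0// expR_ge0.
have env := has_envelopeZ ek0 (has_envelopeD (has_envelopeZ c1 center)
  (has_envelopeD (has_envelopeZ (_ : 0 <= 4^-1) chain)
                 (has_envelopeZ (_ : 0 <= 4^-1) width))).
have p4 : 0 <= 4^-1 :> R by [].
apply: (has_envelope_le (env p4 p4)).
  have kappa_ge0 : 0 <= kappa by apply: mulr_ge0; [lra|exact: msq_ge0].
  rewrite mulrC; apply: ler_pM.
  - apply: addr_ge0; first exact: mulr_ge0 c1 (expR_ge0 _).
    apply: addr_ge0; last exact: mulr_ge0 p4 (expR_ge0 _).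
    apply: (mulr_ge0 p4); apply: addr_ge0; last exact: ler01.
    exact: mulr_ge0 (expR_ge0 _) (expR_ge0 _).
  - exact: expR_ge0.
  - rewrite /cell_const addrA !lerD2r -mulrA ler_piMr// -expRD -[leRHS]expR0 ler_expR.
    lra.
  - rewrite -expRM_natl ler_expR /kappa /cell_rate mulrN lerN2; lra.
move=> _ w [j /= jC <-].
eexists.
  eexists; last by [].
  eexists; eexists; split; last by [].
    by eexists; [reflexivity|].
  eexists; eexists; split; last by [].
    by eexists; [exists j|].
  by eexists; [reflexivity|].
rewrite /=.
set al := 2 * gproc nu D _ - _.
set be := gproc nu (A j) _ - _; set ga := nproc nu _ _.
have split_le : penalized (A j - Ak) w <= al + 2 * be + 2^-1 * ga.
  rewrite (_ : A j - Ak = D + (A j - A a)); last by rewrite [RHS]addrC subrKA.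
  rewrite /be -gprocB; apply: penalized_split.
  by apply: between; rewrite ?CS// amin//= bmax.
rewrite /exp_penalized.
have hc := expR_half_convex (512^-1 * al + kappa / 2)
  (2^-1 * (128^-1 * be) + 2^-1 * (512^-1 * ga)).
have hc2 := expR_half_convex (128^-1 * be) (512^-1 * ga).
rewrite (_ : expR _ = expR (- (kappa / 4))
  * expR (1024^-1 * penalized (A j - Ak) w + kappa / 4)); last first.
  by rewrite -expRD; congr expR; ring.
rewrite ler_wpM2l//.
apply: (@le_trans _ _ (expR (2^-1 * (512^-1 * al + kappa / 2)
  + 2^-1 * (2^-1 * (128^-1 * be) + 2^-1 * (512^-1 * ga))))).
  rewrite ler_expR; lra.
apply: (le_trans hc); rewrite expRD.
move: hc2; move: (expR (kappa / 2)) (expR (512^-1 * al)) (expR (128^-1 * be)) => e1 e2 e3.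
move: (expR (512^-1 * ga)) (expR _) => e4 e5; lra.
Qed.

Lemma side_envelope :
  has_envelope P [set exp_penalized j | j in [set` S]]
    (cell_const / (1 - expR (- cell_rate))).
Proof.
pose N := (\max_(j in S) Num.truncn (pot j)).+1.
have := has_envelope_bigcup (fun m : 'I_N => cell_envelope m).
move=> h; apply: (has_envelope_le h).
  rewrite -mulr_sumr ler_wpM2l ?cell_const_ge0// sum_geometric_le//.
  by rewrite expR_ge0 expR_cell_rate_lt1.
move=> _ w [j /= jS <-]; exists (exp_penalized j) => //.
have jN : (Num.truncn (pot j) < N)%N.
  by rewrite ltnS; exact: (@leq_bigmax_cond _ _ (fun j => Num.truncn (pot j))).
by exists (Ordinal jN) => //; exists j; rewrite //= inE jS eqxx.
Qed.

End Cell.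

Lemma ordered_side_envelope (F G : set 'M[R]_n) (S : {set 'I_M}) (i0 : 'I_M)
    (r : 'M[R]_n -> 'M[R]_n -> Prop) :
  ordered_linear_smoothers F -> ordered_linear_smoothers G -> G Ak ->
  F (A i0) ->
  (forall j, j \in S -> [/\ F (A j), r (A i0) (A j)
    & msq nu (A i0 - Ak) <= msq nu (A j - Ak)]) ->
  (forall i j, i \in S -> j \in S -> r (A i) (A j) \/ r (A j) (A i)) ->
  (forall B C D, F B -> F C -> F D -> r B C -> r C D ->
    increment_superadditive B C D) ->
  has_envelope P [set exp_penalized j | j in [set` S]]
    (cell_const / (1 - expR (- cell_rate))).
Proof.
move=> oF oG GAk Fi0 SP rtot super.
have rB i : i \in S -> r (A i0) (A i) by case/SP.
have FS i : i \in S -> F (A i) by case/SP.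
apply: (@side_envelope S (A i0)).
- by move=> j /FS; exact: smoother_sym.
- exact: smoother_sym GAk.
- by move=> j /FS FAj; exact: smoother_diff_contraction oF oG FAj GAk.
- apply: (@msq_le_potential _ _ _ A r) => // i j iS jS rij.
  by apply: super => //; [exact: FS|exact: FS|exact: rB].
- move=> i j k u; apply: (@potential_between _ _ _ A r) => //.
  + by move=> {}i {}j iS jS rij; apply: super => //; [exact: FS|exact: FS|exact: rB].
  + by move=> {}i {}j {}k iS jS kS; apply: super; exact: FS.
- by move=> j /SP[].
Qed.

(** [Ak] may come from another family: it enters only through its symmetry, the range of the forms
    of [A j - Ak], and the choice of the nearest point [i0]. Every member of [F] is comparable with
    [A i0], so the two sides cover the family. *)
Lemma family_envelope (F G : set 'M[R]_n) :
  ordered_linear_smoothers F -> ordered_linear_smoothers G -> G Ak ->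
  has_envelope P [set exp_penalized j | j in [set j | F (A j)]] family_const.
Proof.
move=> oF oG GAk; have K0 := @family_const_ge0 R.
pose S := [set j | `[< F (A j) >]]%SET.
have SF j : j \in S -> F (A j) by rewrite inE => /asboolP.
have [S0|[j0 j0S]] := set_0Vmem S.
  apply: (has_envelope_le (has_envelope0 P)) => // f w [j /= FAj].
  have : j \in S by rewrite inE; apply/asboolP.
  by rewrite S0 inE.
pose i0 := [arg min_(j < j0 in S) msq nu (A j - Ak)]%O.
have [i0S imin] : i0 \in S /\
    forall j, j \in S -> msq nu (A i0 - Ak) <= msq nu (A j - Ak).
  by rewrite /i0; case: arg_minP => // i iS h; split.
have Fi0 := SF _ i0S; have [_ _ _ tot] := oF.
pose Sup := [set j in S | `[< loewner_le (A i0) (A j) >]]%SET.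
pose Sdn := [set j in S | `[< loewner_le (A j) (A i0) >]]%SET.
have hup : has_envelope P [set exp_penalized j | j in [set` Sup]]
    (cell_const / (1 - expR (- cell_rate))).
  apply: (@ordered_side_envelope F G Sup i0 (@loewner_le R n)) => //.
  - by move=> j; rewrite inE => /andP[jS /asboolP]; split=> //; [exact: SF|exact: imin].
  - move=> i j; rewrite !inE => /andP[/asboolP Fi _] /andP[/asboolP Fj _].
    exact: tot.
  - by move=> B C D; exact: smoother_superadditive.
have hdn : has_envelope P [set exp_penalized j | j in [set` Sdn]]
    (cell_const / (1 - expR (- cell_rate))).
  apply: (@ordered_side_envelope F G Sdn i0 (fun B C => loewner_le C B)) => //.
  - by move=> j; rewrite inE => /andP[jS /asboolP]; split=> //; [exact: SF|exact: imin].
  - move=> i j; rewrite !inE => /andP[/asboolP Fi _] /andP[/asboolP Fj _].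
    exact: tot.
  - move=> B C D FB FC FD CB DC; apply: increment_superadditive_rev.
    exact: (smoother_superadditive oF FD FC FB DC CB).
apply: (has_envelope_le (has_envelopeU hup hdn)).
  by rewrite /family_const mulr_natl.
move=> _ w [j /= FAj <-]; exists (exp_penalized j) => //.
have jS : j \in S by rewrite inE; apply/asboolP.
have [h|h] := tot _ _ Fi0 FAj; [left|right]; exists j => //=;
  by rewrite inE jS; apply/asboolP.
Qed.

Lemma union_envelope q (F : 'I_q -> set 'M[R]_n) :
  (forall k, ordered_linear_smoothers (F k)) ->
  range A `<=` \bigcup_k F k -> (exists k, F k Ak) ->
  has_envelope P (range exp_penalized) (q%:R * family_const).
Proof.
move=> oF AF [k0 Fk0].
have h := has_envelope_bigcup (fun k => family_envelope (oF k) (oF k0) Fk0).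
apply: (has_envelope_le h).
  by rewrite sumr_const card_ord mulr_natl.
move=> _ w [j _ <-]; have [k _ Fk] := AF (A j) (ex_intro2 _ _ j I erefl).
by exists (exp_penalized j) => //; exists k => //; exists j.
Qed.

End Envelopes.

(** * Q-aggregation *)

Section QAggregation.
Context {R : realType} {n M : nat} (sigma : R) (A : 'I_M -> 'M[R]_n).
Implicit Types (theta : 'rV[R]_M) (y z mu : 'cV[R]_n).

Lemma lincomb_mulmx theta y :
  lincomb A theta *m y = \sum_j theta 0 j *: (A j *m y).
Proof. by rewrite mulmx_suml; apply: eq_bigr => j _; rewrite -scalemxAl. Qed.

Lemma lincombD theta theta' : lincomb A (theta + theta') = lincomb A theta + lincomb A theta'.
Proof. by rewrite -big_split/=; apply: eq_bigr => j _; rewrite mxE scalerDl. Qed.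

Lemma lincombZ c theta : lincomb A (c *: theta) = c *: lincomb A theta.
Proof. by rewrite scaler_sumr; apply: eq_bigr => j _; rewrite mxE scalerA. Qed.

Lemma lincomb_delta k : lincomb A (delta_mx 0 k) = A k.
Proof.
rewrite /lincomb (bigD1 k)//= big1 => [|j /negbTE jk]; rewrite mxE eqxx.
  by rewrite eqxx scale1r addr0.
by rewrite jk scale0r.
Qed.

Lemma simplex_delta k : simplex (delta_mx 0 k : 'rV[R]_M).
Proof.
split=> [j|]; first by rewrite mxE ler0n.
rewrite (bigD1 k)//= big1 => [|j /negbTE jk]; rewrite mxE eqxx.
  by rewrite eqxx addr0.
by rewrite jk.
Qed.

Lemma simplex_segment theta theta' (t : R) : 0 <= t <= 1 ->
  simplex theta -> simplex theta' -> simplex ((1 - t) *: theta + t *: theta').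
Proof.
move=> /andP[t0 t1] [p1 s1] [p2 s2]; split=> [j|].
  by rewrite !mxE addr_ge0// mulr_ge0// subr_ge0.
under eq_bigr do rewrite !mxE.
by rewrite big_split/= -!mulr_sumr s1 s2 !mulr1 subrK.
Qed.

(** Equals C_p(A_j) - |A_j y|^2 / 2, the value of the objective at vertex j without its convex
    quadratic part. *)
Definition vertex_cost y j : R :=
  dot y y - 2 * dot (A j *m y) y + 2 * sigma ^+ 2 * \tr (A j)
  + 2^-1 * dot (A j *m y) (A j *m y).

(* On the simplex the penalty turns the objective into a convex quadratic with
   curvature 1 in the direction of [lincomb A theta *m y], plus a linear form. *)
Lemma Qagg_objectiveE y theta : simplex theta ->
  Qagg_objective sigma A y theta
  = 2^-1 * dot (lincomb A theta *m y) (lincomb A theta *m y)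
    + \sum_j theta 0 j * vertex_cost y j.
Proof.
move=> [_ th1]; rewrite /Qagg_objective /mallows_Cp enorm_sqr.
under eq_bigr do rewrite enorm_sqr mulmxBl dotBB.
rewrite dotBB; set b := lincomb A theta *m y.
have bE v : dot b v = \sum_j theta 0 j * dot (A j *m y) v.
  by rewrite /b lincomb_mulmx dot_suml; apply: eq_bigr => j _; rewrite dotZl.
have trE : \tr (lincomb A theta) = \sum_j theta 0 j * \tr (A j).
  by rewrite /lincomb raddf_sum; apply: eq_bigr => j _; rewrite /= mxtraceZ.
have -> : \sum_j theta 0 j
    * (dot b b - 2 * dot b (A j *m y) + dot (A j *m y) (A j *m y))
    = dot b b - 2 * dot b b + \sum_j theta 0 j * dot (A j *m y) (A j *m y).
  transitivity (\sum_j (theta 0 j * dot b b - 2 * (theta 0 j * dot (A j *m y) b)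
     + theta 0 j * dot (A j *m y) (A j *m y))).
    by apply: eq_bigr => j _; rewrite (dotC b (A j *m y)); ring.
  by rewrite big_split/= big_split/= -mulr_suml th1 mul1r sumrN -mulr_sumr -bE.
have -> : \sum_j theta 0 j * vertex_cost y j
    = dot y y - 2 * dot b y + 2 * sigma ^+ 2 * \tr (lincomb A theta)
      + 2^-1 * \sum_j theta 0 j * dot (A j *m y) (A j *m y).
  have <- : \sum_j theta 0 j * dot y y = dot y y by rewrite -mulr_suml th1 mul1r.
  rewrite bE trE !mulr_sumr -sumrN -!big_split/=.
  by apply: eq_bigr => j _; rewrite /vertex_cost; ring.
by field.
Qed.

(** On the segment the objective is its linear interpolation minus t (1 - t) |b|^2 / 2. If the bound
    failed by delta > 0, minimality would give delta <= t |b|^2 / 2, and t = delta / |b|^2 yields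
    delta <= delta / 2. *)
Lemma Qagg_growth y theta theta' :
  is_argmin (@simplex R M) (Qagg_objective sigma A y) theta -> simplex theta' ->
  Qagg_objective sigma A y theta
    + 2^-1 * dot (lincomb A theta' *m y - lincomb A theta *m y)
                 (lincomb A theta' *m y - lincomb A theta *m y)
    <= Qagg_objective sigma A y theta'.
Proof.
move=> [sth thmin] sth'; set b := _ - _; rewrite leNgt; apply/negP => lt0.
set o := Qagg_objective sigma A y in thmin lt0 *.
have le0 := thmin _ sth'.
have b0 : 0 < dot b b by lra.
pose t := (o theta + 2^-1 * dot b b - o theta') / dot b b.
have tE : t * dot b b = o theta + 2^-1 * dot b b - o theta'.
  by rewrite /t divfK// gt_eqF.
have t0 : 0 < t by rewrite divr_gt0// subr_gt0.
have t1 : t <= 1 by rewrite /t ler_pdivrMr// mul1r; lra.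
have t01 : 0 <= t <= 1 by rewrite (ltW t0).
have sseg := simplex_segment t01 sth sth'.
have := thmin _ sseg; rewrite /o !Qagg_objectiveE//.
rewrite lincombD !lincombZ mulmxDl -!scalemxAl.
have -> : \sum_j ((1 - t) *: theta + t *: theta') 0 j * vertex_cost y j
    = (1 - t) * (\sum_j theta 0 j * vertex_cost y j)
      + t * (\sum_j theta' 0 j * vertex_cost y j).
  by rewrite !mulr_sumr -big_split/=; apply: eq_bigr => j _; rewrite !mxE; ring.
move: tE lt0; rewrite /o !Qagg_objectiveE//.
move: b0; rewrite /b !dotBB dotDD !dotZl !dotZr.
move: (\sum_j theta 0 j * _) (\sum_j theta' 0 j * _) => L L'.
set b1 := lincomb A theta *m y; set b2 := lincomb A theta' *m y.
rewrite (dotC b1 b2).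
move: (dot b1 b1) (dot b2 b2) (dot b2 b1) => p q c b0 tE lt0 H.
have : t * (2^-1 * p + L) + 2^-1 * t * (1 - t) * (q - 2 * c + p)
    <= t * (2^-1 * q + L') by lra.
rewrite -[_ * t * _ * _]mulrA -[_ * t * _]mulrA mulrCA -mulrDr ler_pM2l//; lra.
Qed.

(** The penalty of the objective and the gain of [Qagg_growth] at vertex k add up, by the
    bias-variance identity, to half the weighted mean of |(A_j - A_k) y|^2: the source of the
    negative squares. *)
Lemma Qagg_loss_le mu e y theta k : y = mu + e ->
  is_argmin (@simplex R M) (Qagg_objective sigma A y) theta ->
  dot (lincomb A theta *m y - mu) (lincomb A theta *m y - mu)
    - dot (A k *m y - mu) (A k *m y - mu)
  <= \sum_j theta 0 j * (2 * (dot e ((A j - A k) *m y)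
        - sigma ^+ 2 * \tr (A j - A k))
      - 2^-1 * dot ((A j - A k) *m y) ((A j - A k) *m y)).
Proof.
move=> yE thmin; have [sth _] := thmin.
have := Qagg_growth thmin (simplex_delta k).
rewrite !Qagg_objectiveE ?lincomb_delta//; last exact: simplex_delta.
have -> : \sum_j (delta_mx 0 k : 'rV[R]_M) 0 j * vertex_cost y j = vertex_cost y k.
  rewrite (bigD1 k)//= big1 => [|j /negbTE jk]; rewrite mxE eqxx.
    by rewrite eqxx addr0 mul1r.
  by rewrite jk mul0r.
set b := lincomb A theta *m y.
have bE v : dot b v = \sum_j theta 0 j * dot (A j *m y) v.
  by rewrite /b lincomb_mulmx dot_suml; apply: eq_bigr => j _; rewrite dotZl.
have [_ th1] := sth.
set rhs := (X in _ -> _ <= X).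
have -> : rhs = \sum_j theta 0 j * (dot y y - vertex_cost y j)
    - (dot y y - vertex_cost y k) + dot b (A k *m y) - 2 * dot b mu
    - dot (A k *m y) (A k *m y) + 2 * dot (A k *m y) mu.
  rewrite !bE mulr_sumr.
  transitivity (\sum_j (theta 0 j * (dot y y - vertex_cost y j)
     - theta 0 j * (dot y y - vertex_cost y k)
     + theta 0 j * dot (A j *m y) (A k *m y)
     - 2 * (theta 0 j * dot (A j *m y) mu)
     + theta 0 j * (2 * dot (A k *m y) mu - dot (A k *m y) (A k *m y)))).
    apply: eq_bigr => j _; rewrite /vertex_cost mulmxBl linearB/= dotBB dotBr.
    have -> : e = y - mu by rewrite yE addrC addKr.
    rewrite !(dotBl y mu) !(dotC y (_ *m _)) !(dotC mu (_ *m _)); by field.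
  rewrite 4!big_split/= !sumrN -!mulr_suml th1 !mul1r; ring.
have -> : \sum_j theta 0 j * (dot y y - vertex_cost y j)
   = dot y y - \sum_j theta 0 j * vertex_cost y j.
  under eq_bigr do rewrite mulrBr.
  by rewrite big_split/= sumrN -mulr_suml th1 mul1r.
rewrite !dotBB (dotC (A k *m y) b).
move: (\sum_j theta 0 j * _) (vertex_cost y k) => L l.
lra.
Qed.

End QAggregation.

(** * Measurability of the loss *)

Section RationalSimplex.
Context {R : realType} {M : nat}.
Hypothesis M0 : (0 < M)%N.
Implicit Types (v : {ffun 'I_M -> nat}) (theta : 'rV[R]_M).

Lemma cvg_sum_seq (I : Type) (r : seq I) (f : I -> nat -> R) (a : I -> R) :
  (forall i, f i k @[k --> \oo] --> a i) ->
  \sum_(i <- r) f i k @[k --> \oo] --> \sum_(i <- r) a i.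
Proof.
move=> fa; apply: (@cvg_big R^o) => //; exact: add_continuous.
Qed.

(* The shift by 1 makes every [v] a valid point of the simplex. *)
Definition rational_simplex v : 'rV[R]_M :=
  \row_j ((v j).+1%:R / \sum_i (v i).+1%:R).

Lemma rational_simplexP v : simplex (rational_simplex v).
Proof.
have s0 : 0 < \sum_i (v i).+1%:R :> R.
  rewrite (bigD1 (Ordinal M0))//= ltr_pwDl ?ltr0n//.
  by apply: sumr_ge0 => i _; rewrite ler0n.
split=> [j|]; first by rewrite mxE divr_ge0 ?ler0n// ltW.
by under eq_bigr do rewrite mxE; rewrite -mulr_suml divff// gt_eqF.
Qed.

Lemma rational_simplex_cvg theta : simplex theta ->
  exists v : nat -> {ffun 'I_M -> nat},
  forall j, rational_simplex (v k) 0 j @[k --> \oo] --> theta 0 j.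
Proof.
move=> [th0 th1].
(* (v_j + 1) / (k + 1) lies between theta_j and theta_j + 1 / (k + 1), so the normalizing sum,
   divided by k + 1, tends to 1. *)
pose v k : {ffun 'I_M -> nat} := [ffun j => Num.truncn (k.+1%:R * theta 0 j)].
exists v => j; pose a i k : R := (v k i).+1%:R * harmonic k.
have acvg i : a i k @[k --> \oo] --> theta 0 i.
  apply: (@squeeze_cvgr _ _ _ _ (fun=> theta 0 i) (fun k => theta 0 i + harmonic k)).
  - apply: nearW => k; rewrite /a ffunE /harmonic.
    have k0 : 0 < k.+1%:R :> R by rewrite ltr0n.
    have := truncn_itv (mulr_ge0 (ltW k0) (th0 i)) => /andP[h1 h2].
    apply/andP; split.
      by rewrite ler_pdivlMr// mulrC ltW.
    rewrite ler_pdivrMr// mulrDl mulVf ?gt_eqF// -[(Num.truncn _).+1%:R]natr1.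
    by rewrite lerD2r (mulrC (theta 0 i)).
  - exact: cvg_cst.
  - rewrite -[X in _ --> X]addr0; apply: cvgD; first exact: cvg_cst.
    exact: cvg_harmonic.
have scvg : (\sum_i a i k)^-1 @[k --> \oo] --> (1 : R)^-1.
  apply: cvgV; first by rewrite oner_eq0.
  by rewrite -[X in _ --> X]th1; exact: cvg_sum_seq.
rewrite -[theta 0 j]mulr1 -[1]invr1.
have -> : (fun k => rational_simplex (v k) 0 j)
    = (fun k => a j k * (\sum_i a i k)^-1).
  apply/funext => k; rewrite mxE /a -mulr_suml invfM mulrACA divff ?mulr1//.
  by rewrite /harmonic invr_eq0 pnatr_eq0.
exact: cvgM.
Qed.

End RationalSimplex.

Section MeasurableLoss.
Context d (T : measurableType d) {R : realType} {n M : nat}.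
Variables (sigma : R) (A : 'I_M -> 'M[R]_n) (y : T -> 'cV[R]_n).
Variables (thetahat : T -> 'rV[R]_M) (mu : 'cV[R]_n).
Hypothesis M0 : (0 < M)%N.
Hypothesis my : measurable_mx y.
Hypothesis thetahatP : forall w,
  is_argmin (@simplex R M) (Qagg_objective sigma A (y w)) (thetahat w).

Let obj theta w := Qagg_objective sigma A (y w) theta.
Let loss theta w := dot (lincomb A theta *m y w - mu) (lincomb A theta *m y w - mu).

Let measurable_loss_at theta : measurable_fun setT (loss theta).
Proof.
have h : measurable_mx (fun w => lincomb A theta *m y w - mu).
  apply: measurable_mxB; last exact: measurable_mx_cst.
  by apply: measurable_mxM => //; exact: measurable_mx_cst.
exact: measurable_dot.
Qed.

Let measurable_obj_at theta : measurable_fun setT (obj theta).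
Proof.
have m1 (B : 'M[R]_n) : measurable_mx (fun w => B *m y w).
  by apply: measurable_mxM => //; exact: measurable_mx_cst.
rewrite /obj /Qagg_objective /mallows_Cp; apply: measurable_funD.
  apply: measurable_funD => //; under eq_fun do rewrite enorm_sqr.
  by apply: measurable_dot; apply: measurable_mxB.
apply: measurable_funM => //; apply: measurable_sum => j.
apply: measurable_funM => //; under eq_fun do rewrite enorm_sqr.
exact: measurable_dot.
Qed.

Let approximation w theta (e : R) : simplex theta -> 0 < e ->
  exists v, obj (rational_simplex v) w <= obj theta w + e /\
            loss (rational_simplex v) w <= loss theta w + e.
Proof.
move=> sth e0; have [v vcvg] := rational_simplex_cvg sth.
have dcvg u : dot (lincomb A (rational_simplex (v k)) *m y w) u @[k --> \oo]
    --> dot (lincomb A theta *m y w) u.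
  have dE th : dot (lincomb A th *m y w) u = \sum_j th 0 j * dot (A j *m y w) u.
    by rewrite lincomb_mulmx dot_suml; apply: eq_bigr => j _; rewrite dotZl.
  rewrite dE; under eq_cvg do rewrite dE.
  by apply: cvg_sum_seq => j; apply: cvgM => //; exact: cvg_cst.
have qcvg : dot (lincomb A (rational_simplex (v k)) *m y w)
      (lincomb A (rational_simplex (v k)) *m y w) @[k --> \oo]
    --> dot (lincomb A theta *m y w) (lincomb A theta *m y w).
  have dE th : dot (lincomb A th *m y w) (lincomb A th *m y w)
      = \sum_j th 0 j * dot (lincomb A th *m y w) (A j *m y w).
    rewrite {1}lincomb_mulmx dot_suml; apply: eq_bigr => j _.
    by rewrite dotZl dotC.
  rewrite dE; under eq_cvg do rewrite dE.
  by apply: cvg_sum_seq => j; exact: cvgM.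
have objcvg : obj (rational_simplex (v k)) w @[k --> \oo] --> obj theta w.
  rewrite /obj Qagg_objectiveE//.
  under eq_cvg do rewrite (Qagg_objectiveE _ _ _ (rational_simplexP M0 _)).
  apply: cvgD; first by apply: cvgM => //; exact: cvg_cst.
  by apply: cvg_sum_seq => j; apply: cvgM => //; exact: cvg_cst.
have losscvg : loss (rational_simplex (v k)) w @[k --> \oo] --> loss theta w.
  rewrite /loss dotBB; under eq_cvg do rewrite dotBB.
  apply: cvgD; last exact: cvg_cst; apply: cvgB => //.
  by apply: cvgM => //; exact: cvg_cst.
have obj_lt : obj theta w < obj theta w + e by rewrite ltrDl.
have loss_lt : loss theta w < loss theta w + e by rewrite ltrDl.
have nobj : \forall k \near \oo, obj (rational_simplex (v k)) w <= obj theta w + e.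
  exact: (@cvgr_le _ _ _ _ (fun k => obj (rational_simplex (v k)) w) _ objcvg).
have nloss : \forall k \near \oo, loss (rational_simplex (v k)) w <= loss theta w + e.
  exact: (@cvgr_le _ _ _ _ (fun k => loss (rational_simplex (v k)) w) _ losscvg).
by near \oo => k; exists (v k); split; near: k.
Unshelve. all: by end_near. Qed.

(* [thetahat] is not assumed measurable, but by strong convexity near-minimizers
   among countably many rational weights determine the aggregate. *)
Let loss_leP w c : loss (thetahat w) w <= c <-> forall k : nat,
  exists v : {ffun 'I_M -> nat},
    (forall v' : {ffun 'I_M -> nat}, obj (rational_simplex v) w
       <= obj (rational_simplex v') w + k.+1%:R^-1 ^+ 2) /\
    loss (rational_simplex v) w <= c + k.+1%:R^-1.
Proof.
have [sth thmin] := thetahatP w; split=> [lc k|H].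
  have e0 : 0 < k.+1%:R^-1 :> R by rewrite invr_gt0 ltr0n.
  have e1 : k.+1%:R^-1 <= 1 :> R by rewrite invf_le1 ?ltr0n// ler1n.
  have e20 : 0 < k.+1%:R^-1 ^+ 2 :> R by rewrite exprn_gt0.
  have [v [h1 h2]] := approximation w sth e20; exists v; split=> [v'|].
    by rewrite (le_trans h1)// lerD2r thmin//; exact: rational_simplexP.
  rewrite (le_trans h2)// lerD// expr2 ler_piMl// ltW//.
apply/ler_addgt0Pr => e e0.
(* The final estimate is c + eps (6 + c): eps from the near-minimizer, eps (c + 1) + 2 eps from the
   cross term, 2 eps from |D|^2. *)
pose K := 6 + `|c|; have K0 : 0 < K by rewrite ltr_pwDl.
pose k := Num.truncn (K / e).
have [v [h1 h2]] := H k.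
set eps := k.+1%:R^-1 in h1 h2.
have eps0 : 0 < eps by rewrite invr_gt0 ltr0n.
have eps1 : eps <= 1 by rewrite invf_le1 ?ltr0n// ler1n.
have epsK : eps * K <= e.
  rewrite mulrC ler_pdivrMr ?ltr0n// mulrC -ler_pdivrMr//.
  exact/ltW/truncnS_gt.
have le_obj : obj (rational_simplex v) w <= obj (thetahat w) w + eps ^+ 2.
  apply/ler_addgt0Pr => e' e'0; have [v' [h _]] := approximation w sth e'0.
  by apply: le_trans (h1 v') _; rewrite [leRHS]addrAC lerD2r.
have growth := Qagg_growth (thetahatP w) (rational_simplexP M0 v).
move: growth le_obj h2; rewrite /obj /loss.
set bv := lincomb A (rational_simplex v) *m y w.
set b := lincomb A (thetahat w) *m y w; set D := bv - b => growth le_obj h2.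
(* The tolerance eps^2 on the objective becomes a distance of order eps; the cross term is then
   handled by |eps (bv - mu) + D|^2 >= 0, divided by eps. *)
have D2 : dot D D <= 2 * eps ^+ 2 by lra.
rewrite (_ : b - mu = (bv - mu) - D); last by rewrite /D opprB [RHS]addrC subrKA.
have := dot_ge0 (eps *: (bv - mu) + D).
rewrite (dotDD (eps *: (bv - mu)) D) (dotBB (bv - mu) D) !dotZl !dotZr.
move: h2; set p := dot (bv - mu) (bv - mu); set q := dot (bv - mu) D.
move: D2; set r := dot D D => D2 h2 sq.
have eps2 : 0 <= eps ^+ 2 by exact: sqr_ge0.
have r0 : 0 <= r := dot_ge0 _.
have h3 : eps * (- 2 * q) <= eps * (eps * p + 2 * eps).
  apply: le_trans (_ : eps * (eps * p) + r <= _); first by lra.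
  by rewrite mulrDr lerD2l; apply: le_trans D2 _; rewrite expr2 mulrCA.
rewrite ler_pM2l// in h3.
have h4 : eps * p <= eps * (c + 1).
  by rewrite ler_pM2l// (le_trans h2)// lerD2l.
have h5 : r <= 2 * eps.
  by rewrite (le_trans D2)// ler_pM2l// expr2 ler_piMl// ltW.
have h6 : eps * c <= eps * `|c| by rewrite ler_pM2l// ler_norm.
move: epsK; rewrite /K; lra.
Qed.

Let measurable_le (f g : T -> R) : measurable_fun setT f ->
  measurable_fun setT g -> measurable [set w | f w <= g w].
Proof. by move=> mf mg; rewrite -[X in measurable X]setTI; exact: measurable_fun_le. Qed.

Lemma measurable_aggregate_loss :
  measurable_fun setT (fun w => enorm (lincomb A (thetahat w) *m y w - mu) ^+ 2).
Proof.
under eq_fun do rewrite enorm_sqr.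
apply: (measurability _ (RGenOInfty.measurableE R)) => /= _ -[_ [c ->] <-].
have -> : [set: T] `&` (fun w => loss (thetahat w) w) @^-1` `]c, +oo[
  = ~` \bigcap_(k : nat) \bigcup_(v : {ffun 'I_M -> nat})
      ((~` \bigcup_(v' : {ffun 'I_M -> nat})
          ~` [set w | obj (rational_simplex v) w
               <= obj (rational_simplex v') w + k.+1%:R^-1 ^+ 2])
       `&` [set w | loss (rational_simplex v) w <= c + k.+1%:R^-1]).
  rewrite setTI; apply/seteqP; split=> w /=.
    rewrite in_itv/= andbT ltNge => /negP h H; apply: h; apply/loss_leP => k.
    have [v _ [/= h1 h2]] := H k Logic.I; exists v; split=> // v'.
    by apply: contrapT => h; apply: h1; exists v'.
  move=> H; rewrite in_itv/= andbT ltNge; apply/negP => h; apply: H => k _.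
  move/loss_leP: h => /(_ k)[v [h1 h2]]; exists v => //; split=> //=.
  by move=> [v' _]; apply; exact: h1.
apply: measurableC; apply: bigcapT_measurable => k.
apply: countable_bigcupT_measurable => [|v]; first exact: countableP.
apply: measurableI; last exact: measurable_le.
apply: measurableC; apply: countable_bigcupT_measurable => [|v'].
  exact: countableP.
apply: measurableC; apply: measurable_le => //.
exact: measurable_funD.
Qed.

End MeasurableLoss.

(** * The oracle inequality *)

Section OracleInequality.
Context {R : realType} (n M q : nat) (sigma : R) (mu : 'cV[R]_n).
Context (d : measure_display) (T : measurableType d) (P : probability T R).
Variables (eps : 'I_n -> {RV P >-> R}) (A : 'I_M -> 'M[R]_n).
Variables (F : 'I_q -> set 'M[R]_n) (thetahat : T -> 'rV[R]_M).
(* [C] is an abstract name for 1024: tactics would unfold the literal to unary. *)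
Variable C : R.
Hypothesis CE : C = 1024.
Hypotheses (M0 : (0 < M)%N) (q0 : (0 < q)%N) (sigma0 : 0 < sigma).
Hypothesis gauss : isotropic_gaussian sigma eps.
Hypothesis oF : forall k : 'I_q, ordered_linear_smoothers (F k).
Hypothesis AF : range A `<=` \bigcup_(k in [set: 'I_q]) F k.
Let y := observation mu eps.
Hypothesis thetahatP : forall w : T,
  is_argmin (@simplex R M) (Qagg_objective sigma A (y w)) (thetahat w).
Let loss (w : T) := enorm (lincomb A (thetahat w) *m y w - mu) ^+ 2.
Let loss_ (j : 'I_M) (w : T) := enorm (A j *m y w - mu) ^+ 2.
Let nu := sigma^-1 *: mu.
Let Delta k j w := penalized sigma eps nu (A j - A k) w.

Let s2_gt0 : 0 < sigma ^+ 2. Proof. by rewrite exprn_gt0. Qed.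
Let C_gt0 : 0 < C. Proof. by rewrite CE ltr0n. Qed.
Let q_gt0 : 0 < q%:R :> R. Proof. by rewrite ltr0n. Qed.

Let measurable_y : measurable_mx y.
Proof.
apply: measurable_mxD; first exact: measurable_mx_cst.
by move=> i j; under eq_fun do rewrite mxE; exact: measurable_funP.
Qed.

Let measurable_loss : measurable_fun setT loss.
Proof. exact: measurable_aggregate_loss. Qed.

Let measurable_loss_ j : measurable_fun setT (loss_ j).
Proof.
rewrite /loss_; under eq_fun do rewrite enorm_sqr.
have h : measurable_mx (fun w => A j *m y w - mu).
  apply: measurable_mxB; last exact: measurable_mx_cst.
  by apply: measurable_mxM => //; exact: measurable_mx_cst.
exact: measurable_dot.
Qed.

Let loss_ge0 w : 0 <= loss w. Proof. exact: sqr_ge0. Qed.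
Let loss__ge0 j w : 0 <= loss_ j w. Proof. exact: sqr_ge0. Qed.

Let loss_le k w :
  loss w - loss_ k w <= sigma ^+ 2 * \sum_j thetahat w 0 j * Delta k j w.
Proof.
rewrite /loss /loss_ !enorm_sqr.
have yE : y w = mu + sigma *: gvec sigma eps w.
  congr (_ + _); apply/matrixP => i j; rewrite !mxE mulrC divfK//.
  by rewrite gt_eqF.
have yE2 : y w = sigma *: (nu + gvec sigma eps w).
  by rewrite yE scalerDr /nu scalerA divff ?scale1r// gt_eqF.
apply: (le_trans (Qagg_loss_le k yE (thetahatP w))).
rewrite mulr_sumr le_eqVlt; apply/orP; left; apply/eqP/eq_bigr => j _.
rewrite /Delta /penalized /gproc /nproc yE2 -scalemxAr !dotZl !dotZr; ring.
Qed.

Let loss_le_max k w b : (forall j, Delta k j w <= b) ->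
  loss w - loss_ k w <= sigma ^+ 2 * b.
Proof.
move=> Db; have [[th0 th1] _] := thetahatP w.
apply: (le_trans (loss_le k w)); rewrite ler_wpM2l ?(ltW s2_gt0)//.
rewrite -[b]mul1r -[X in _ <= X * _]th1 mulr_suml.
by apply: ler_sum => j _; rewrite ler_wpM2l.
Qed.

Let envelope k : exists W : T -> R, [/\ measurable_fun setT W,
  forall w, 0 <= W w, (\int[P]_w (W w)%:E <= (q%:R * family_const)%:E)%E &
  forall j w, expR (C^-1 * Delta k j w) <= W w].
Proof.
have [k0 _ Fk0] := AF (ex_intro2 _ _ k Logic.I erefl).
have [W [mW W0 WK DW]] := union_envelope nu gauss sigma0 oF AF (ex_intro _ k0 Fk0).
exists W; split=> // j w; rewrite CE.
by apply: (DW (exp_penalized sigma eps nu A (A k) j)); exists j.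
Qed.

Let Delta_le_envelope (W : T -> R) k j w : expR (C^-1 * Delta k j w) <= W w ->
  Delta k j w <= C * (ln q%:R + q%:R^-1 * W w).
Proof.
move=> DW; have := expR_ge1Dx (C^-1 * Delta k j w - ln q%:R).
rewrite expRB lnK ?posrE// => h.
have : expR (C^-1 * Delta k j w) / q%:R <= q%:R^-1 * W w.
  by rewrite mulrC ler_pM2l ?invr_gt0.
move=> h'; rewrite -ler_pdivrMl//.
move: (ln _) (q%:R^-1 * W w) (expR _ / _) h h' => l a b h ba; lra.
Qed.

(** Stated additively, so that it is meaningful when the risks are infinite; it integrates the
    pointwise bound by [loss_ k], a constant and a multiple of [W]. *)
Lemma expected_loss_le k :
  ('E_P[loss] <= 'E_P[loss_ k]
     + (C * sigma ^+ 2 * family_const + C * sigma ^+ 2 * ln q%:R)%:E)%E.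
Proof.
have [W [mW W0 WK DW]] := envelope k.
have lq : 0 <= ln q%:R :> R by rewrite ln_ge0// ler1n.
rewrite unlock /expectation.body.
pose c := C * sigma ^+ 2 * ln q%:R; pose b := C * sigma ^+ 2 / q%:R.
have c0 : 0 <= c by apply: mulr_ge0 => //; apply: mulr_ge0; exact: ltW.
have b0 : 0 <= b.
  by apply: divr_ge0; [apply: mulr_ge0; exact: ltW|exact: ltW].
have mEloss k' : measurable_fun setT (EFin \o loss_ k') by exact/measurable_EFinP.
have mEW : measurable_fun setT (EFin \o W) by exact/measurable_EFinP.
apply: (@le_trans _ _ (\int[P]_w ((loss_ k w)%:E + (c%:E + b%:E * (W w)%:E)))%E).
  apply: ge0_le_integral => //.
  - by move=> w _; rewrite lee_fin.
  - exact/measurable_EFinP.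
  - apply: emeasurable_funD; first exact: mEloss.
    by apply: emeasurable_funD; [exact: measurable_cst|exact: measurable_funeM].
  move=> w _; rewrite -EFinM -!EFinD lee_fin -lerBlDl.
  apply: (le_trans (loss_le_max (fun j => Delta_le_envelope (DW j w)))).
  rewrite le_eqVlt; apply/orP; left; apply/eqP; rewrite /c /b; ring.
have h1 w : [set: T] w -> (0 <= (loss_ k w)%:E)%E by rewrite lee_fin.
have h2 w : [set: T] w -> (0 <= b%:E * (W w)%:E)%E by rewrite mule_ge0// lee_fin.
have h3 w : [set: T] w -> (0 <= c%:E)%E by rewrite lee_fin.
have h4 w : [set: T] w -> (0 <= c%:E + b%:E * (W w)%:E)%E.
  by move=> wT; apply: adde_ge0; [exact: h3 wT|exact: h2].
have h5 w : [set: T] w -> (0 <= (W w)%:E)%E by rewrite lee_fin.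
have m0 : measurable_fun [set: T] (fun=> c%:E) by exact: measurable_cst.
have m1 : measurable_fun setT (fun w => b%:E * (W w)%:E)%E by exact: measurable_funeM.
have m2 : measurable_fun setT (fun w => c%:E + b%:E * (W w)%:E)%E.
  by apply: emeasurable_funD; first exact: measurable_cst.
rewrite (ge0_integralD P measurableT h1 (mEloss k) h4 m2) leeD2l//.
rewrite (ge0_integralD P measurableT h3 m0 h2 m1).
rewrite integral_probability_cst (ge0_integralZl P measurableT mEW h5)//.
apply: (@le_trans _ _ (c%:E + b%:E * (q%:R * family_const)%:E)%E).
  by rewrite leeD2l// lee_wpmul2l// lee_fin.
rewrite -EFinM -EFinD lee_fin le_eqVlt; apply/orP; left; apply/eqP.
by rewrite /b /c; field; rewrite gt_eqF.
Qed.

(** Markov's inequality for [W] at level q e^x: where [W] stays below it, every [Delta k j] is at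
    most C (x + ln q). The factor q cancels against the mean of [W]. *)
Lemma loss_deviation k x : ((1 - family_const * expR (- x))%:E <=
  P [set w | (loss w - loss_ k w <= C * sigma ^+ 2 * (x + ln q%:R))%R])%E.
Proof.
have [W [mW W0 WK DW]] := envelope k.
set S := [set w | _].
have mS : measurable S.
  rewrite -[S]setTI; apply: measurable_fun_le => //; exact: measurable_funB.
have PS : (P (~` S) <= (family_const * expR (- x))%:E)%E.
  pose a := q%:R * expR x; have a0 : 0 < a by rewrite mulr_gt0// expR_gt0.
  have mEW : measurable_fun setT (EFin \o W) by exact/measurable_EFinP.
  have := le_integral_abse P measurableT mEW a0.
  rewrite setTI; set V := [set w | _] => h.
  have SV : ~` S `<=` V.
    move=> w /= /negP; rewrite -ltNge => Sw.
    rewrite /V /= ger0_norm// lee_fin leNgt; apply/negP => Wa.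
    move: Sw; rewrite ltNge => /negP; apply.
    rewrite -mulrA mulrCA; apply: loss_le_max => j.
    rewrite -ler_pdivrMl// -ler_expR (le_trans (DW j w))// expRD lnK ?posrE//.
    by rewrite mulrC; exact: ltW.
  have mV : measurable V.
    rewrite (_ : V = [set w | a <= W w]); last first.
      by apply/seteqP; split=> w; rewrite /V /= lee_fin ger0_norm.
    by rewrite -[X in measurable X]setTI; exact: measurable_fun_le.
  have PV : (a%:E * P V <= (q%:R * family_const)%:E)%E.
    apply: (le_trans h); apply: le_trans WK.
    by rewrite le_eqVlt; apply/orP; left; apply/eqP/eq_integral => w _; rewrite /= ger0_norm.
  apply: (@le_trans _ _ (P V)).
    by apply: le_measure; rewrite ?inE//; exact: measurableC.
  rewrite -(@lee_pmul2l _ a%:E)// ?lte_fin//; apply: (le_trans PV).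
  rewrite -EFinM lee_fin /a expRN.
  rewrite (_ : _ * _ * _ = q%:R * family_const * (expR x * (expR x)^-1)); last by ring.
  by rewrite divff ?mulr1// gt_eqF// expR_gt0.
rewrite EFinB leeBlDr// ; have := probability_setC P mS => PC.
have : (P S + P (~` S))%E = 1%E.
  by rewrite PC addeC subeK// fin_num_measure.
by move=> <-; rewrite leeD2l.
Qed.

End OracleInequality.

Theorem theorem4p1 (R : realType) :
  exists C1 C2 C3 : R, [/\ 0 < C1, 0 < C2, 0 < C3 &
  forall (n M q : nat) (sigma : R) (mu : 'cV[R]_n)
    (d : measure_display) (T : measurableType d) (P : probability T R)
    (eps : 'I_n -> {RV P >-> R})
    (A : 'I_M -> 'M[R]_n) (F : 'I_q -> set 'M[R]_n)
    (thetahat : T -> 'rV[R]_M),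
  (0 < n)%N -> (0 < M)%N -> (0 < q)%N -> 0 < sigma ->
  isotropic_gaussian sigma eps ->
  (forall k : 'I_q, ordered_linear_smoothers (F k)) ->
  range A `<=` \bigcup_(k in [set: 'I_q]) F k ->
  let y := observation mu eps in
  (forall w : T,
    is_argmin (@simplex R M) (Qagg_objective sigma A (y w)) (thetahat w)) ->
  let loss (w : T) := enorm (lincomb A (thetahat w) *m y w - mu) ^+ 2 in
  let loss_ (j : 'I_M) (w : T) := enorm (A j *m y w - mu) ^+ 2 in
  ('E_P[loss] - \big[Order.min/+oo]_(j < M) 'E_P[loss_ j]
     <= (C1 * sigma ^+ 2 + C2 * sigma ^+ 2 * ln q%:R)%:E)%E
  /\
  (forall jstar : 'I_M,
    (forall j : 'I_M, ('E_P[loss_ jstar] <= 'E_P[loss_ j])%E) ->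
    forall x : R, 1 <= x ->
    ((1 - C3 * expR (- x))%:E <=
      P [set w | (loss w - loss_ jstar w <=
                    C2 * sigma ^+ 2 * (x + ln q%:R))%R])%E)].
Proof.
have K0 := @family_const_ge0 R.
have [C C0 CE] : exists2 C : R, 0 < C & C = 1024 by exists 1024; rewrite ?ltr0n.
have K1 : 0 < family_const + 1 :> R by rewrite ltr_wpDl.
(* The added 1 makes the constants strictly positive, [family_const] being known only to be
   nonnegative. *)
exists (C * (family_const + 1)), C, (family_const + 1); split=> //.
  exact: mulr_gt0.
move=> n M q sigma mu d T P eps A F thetahat n0 M0 q0 s0 gauss oF AF y thP loss loss_.
split=> [|j _ x _].
  rewrite (bigmin_eq_arg _ (Ordinal M0))//; last by move=> i _; exact: leey.
  set k := [arg min_(_ < _) _]%O.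
  have le := expected_loss_le CE M0 q0 s0 gauss oF AF thP k.
  have E0 : (0 <= 'E_P[loss])%E.
    by rewrite unlock; apply: integral_ge0 => w _; rewrite lee_fin sqr_ge0.
  have Ek0 : (0 <= 'E_P[loss_ k])%E.
    by rewrite unlock; apply: integral_ge0 => w _; rewrite lee_fin sqr_ge0.
  (* If the smallest risk is infinite, the difference is -oo by the conventions of extended
     addition; otherwise it can be moved to the other side. *)
  have [Ekoo|Ekfin] := eqVneq ('E_P[loss_ k])%E +oo%E.
    by rewrite Ekoo /= addeNy leNye.
  rewrite leeBlDr; last by rewrite ge0_fin_numE// ltey.
  apply: (le_trans le); rewrite addeC leeD2r// lee_fin lerD2r.
  by rewrite [leLHS]mulrAC ler_wpM2r ?sqr_ge0// ler_pM2l// lerDl.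
apply: le_trans (loss_deviation CE M0 q0 s0 gauss oF AF thP j x).
by rewrite lee_fin lerD2l lerN2 ler_wpM2r ?expR_ge0// lerDl.
Qed.
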